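(* Let $\varphi_0:L^\infty\to\mathbb{R}$ be a finite-valued monotone convex function with the Lebesgue property on $L^\infty$ and $\varphi_0(0)=0$. Let $\hat\varphi$ and $M^{\hat\varphi}_u$ be the function and the space associated to $\varphi_0$ as defined in the context. Then the pair $(\hat\varphi,M^{\hat\varphi}_u)$ is the maximum Lebesgue extension of $\varphi_0$, i.e.: (1) $M^{\hat\varphi}_u$ is a solid subspace of $L^0$ containing the constants, $\hat\varphi:M^{\hat\varphi}_u\to\mathbb{R}$ is a (finite-valued) monotone convex function with the Lebesgue property on $M^{\hat\varphi}_u$, and $\hat\varphi|_{L^\infty}=\varphi_0$; (2) if $(\varphi,\mathcal{X})$ is any pair satisfying the conditions of (1) (that is, $\mathcal{X}$ is a solid subspace of $L^0$ containing the constants, and $\varphi:\mathcal{X}\to\mathbb{R}$ is a monotone convex function with the Lebesgue property on $\mathcal{X}$ and $\varphi|_{L^\infty}=\varphi_0$), then $\mathcal{X}\subset M^{\hat\varphi}_u$ and $\varphi=\hat\varphi|_{\mathcal{X}}$.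
   Context: $(\Omega,\mathcal{F},\mathbb{P})$ is a probability space; $L^0$ is the space of finite real random variables modulo $\mathbb{P}$-a.s. equality with the a.s. pointwise order; $L^p=L^p(\Omega,\mathcal F,\mathbb P)$; $\mathbb{E}$ is expectation under $\mathbb{P}$; $X^-=\max(-X,0)$. A solid space is a linear subspace $\mathcal{X}\subset L^0$ such that $|X|\le|Y|$ a.s. and $Y\in\mathcal{X}$ imply $X\in\mathcal{X}$. A monotone convex function on a solid space $\mathcal{X}$ is a proper convex function $\varphi:\mathcal{X}\to(-\infty,\infty]$ with $X\le Y$ a.s. $\Rightarrow\varphi(X)\le\varphi(Y)$. It has the Lebesgue property on $\mathcal{X}$ if for every sequence $(X_n)\subset\mathcal{X}$: if there is $Y\in\mathcal{X}$, $Y\geq 0$, with $|X_n|\le Y$ for all $n$ and $X_n\to X$ a.s., then $\varphi(X)=\lim_n\varphi(X_n)$. Lebesgue extensions: a pair $(\varphi,\mathcal{X})$ is a Lebesgue extension of $\varphi_0$ if $\mathcal{X}\subset L^0$ is a solid space containing $L^\infty$, $\varphi:\mathcal{X}\to(-\infty,\infty]$ is a monotone convex function with the Lebesgue property on $\mathcal{X}$, and $\varphi|_{L^\infty}=\varphi_0$. A Lebesgue extension $(\hat\varphi,\widehat{\mathcal{X}})$ is the maximum Lebesgue extension if for every Lebesgue extension $(\varphi,\mathcal{X})$ one has $\mathcal{X}\subset\widehat{\mathcal{X}}$ and $\varphi=\hat\varphi|_{\mathcal{X}}$. Definitions associated to $\varphi_0$: $\varphi_0^*(Z)=\sup_{X\in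 L^\infty}(\mathbb{E}[XZ]-\varphi_0(X))$ for $Z\in L^1$, $\mathrm{dom}\,\varphi_0^*=\{Z\in L^1:\varphi_0^*(Z)<\infty\}$ (every element of which is $\ge0$ by monotonicity); $\mathcal{D}_0=\{X\in L^0: X^-Z\in L^1\ \forall Z\in\mathrm{dom}\,\varphi_0^*\}$; $$\hat\varphi(X)=\sup_{Z\in\mathrm{dom}\,\varphi_0^*}\big(\mathbb{E}[XZ]-\varphi_0^*(Z)\big)\in(-\infty,\infty],\quad X\in\mathcal{D}_0;$$ $$M^{\hat\varphi}_u=\Big\{X\in L^0:\ \lim_{N\to\infty}\hat\varphi\big(\alpha|X|\mathbf{1}_{\{|X|>N\}}\big)=0\ \ \forall\alpha>0\Big\}$$ (one has $L^0_+\subset\mathcal D_0$ and $M^{\hat\varphi}_u\subset\mathcal D_0$, so these are meaningful). *)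

(* Defs.v *)
From HB Require Import structures.
From mathcomp Require Import all_boot all_order all_algebra.
From mathcomp Require Import all_classical all_reals all_analysis.
From mathcomp Require Import measurable_realfun.

Set Implicit Arguments.
Unset Strict Implicit.
Unset Printing Implicit Defensive.

Import Order.TTheory GRing.Theory Num.Theory.
Import numFieldNormedType.Exports.

Local Open Scope classical_set_scope.
Local Open Scope ring_scope.

(* L^0 is the library's quotient {mfun_ P, T >-> R} of the measurable functions
   by P-a.e. equality.  Its elements coerce to functions through a chosen
   representative, so a pointwise formula in X is used below only under [\ae P]
   or an integral, or is sent back to the quotient by [L0of]. *)
Section L0_operations.
Context d (T : measurableType d) (R : realType) (P : probability T R).
Implicit Types X Y : {mfun_ P, T >-> R}.

Definition L0of (f : T -> R) (mf : measurable_fun setT f) :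
  {mfun_ P, T >-> R} := (\pi_({mfun_ P, T >-> R}) (mfun_Sub (mem_set mf)))%qT.

Lemma L0ofE (f : T -> R) (mf : measurable_fun setT f) :
  \forall w \ae P, L0of mf w = f w.
Proof.
have /eqmodP/asboolP := reprK (L0of mf).
by apply: filterS => w /(_ I).
Qed.

Lemma measurable_L0 X : measurable_fun setT (X : T -> R).
Proof. exact: measurable_funPT (repr X). Qed.

Definition L0cst (c : R) : {mfun_ P, T >-> R} :=
  L0of (measurable_cst c).

Definition L0add X Y : {mfun_ P, T >-> R} :=
  L0of (measurable_funD (measurable_L0 X) (measurable_L0 Y)).

Definition L0scale (a : R) X : {mfun_ P, T >-> R} :=
  L0of (measurable_funM (measurable_cst a) (measurable_L0 X)).

Definition L0le X Y : Prop := \forall w \ae P, X w <= Y w.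

Definition tail_fun (a : R) (N : nat) (f : T -> R) : T -> R :=
  fun w => a * `|f w| * \1_[set v | N%:R < `|f v|] w.

Lemma measurable_tail_fun (a : R) (N : nat) (f : T -> R) :
  measurable_fun setT f -> measurable_fun setT (tail_fun a N f).
Proof.
move=> mf.
have mnf : measurable_fun setT (fun w => `|f w|) by exact: measurableT_comp.
apply: measurable_funM; first exact: measurable_funM.
apply: measurable_indic.
rewrite (_ : [set v | _] = (fun w => `|f w|) @^-1` `]N%:R, +oo[).
  by rewrite -[X in measurable X]setTI; apply: mnf.
by apply/seteqP; split => w /=; rewrite in_itv/= andbT.
Qed.

Definition L0tail (a : R) (N : nat) X : {mfun_ P, T >-> R} :=
  L0of (measurable_tail_fun a N (measurable_L0 X)).

Definition L1 : set {mfun_ P, T >-> R} :=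
  [set X | (X : T -> R) \in Lfun P 1%E].

Definition Linfty : set {mfun_ P, T >-> R} :=
  [set X | (X : T -> R) \in Lfun P +oo%E].

End L0_operations.
Arguments L0cst {d T R} P c.
Arguments L1 {d T R} P.
Arguments Linfty {d T R} P.

(* A function on a subset of L^0 is encoded as a total function on L^0 whose
   values outside that subset are never used. *)
Section Lebesgue_extensions.
Context d (T : measurableType d) (R : realType) (P : probability T R).
Local Notation L0 := {mfun_ P, T >-> R}.
Implicit Types (S : set L0) (phi : L0 -> \bar R).

Definition linear_subspace S : Prop :=
  [/\ S (L0cst P 0),
      forall X Y, S X -> S Y -> S (L0add X Y) &
      forall a X, S X -> S (L0scale a X)].

Definition solid_space S : Prop :=
  linear_subspace S /\
  forall X Y : L0, (\forall w \ae P, `|X w| <= `|Y w|) -> S Y -> S X.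

(* The convention 0 * +oo = 0 makes the cases t = 0 and t = 1 trivial. *)
Definition convex_on S phi : Prop :=
  forall (t : R) (X Y : L0), 0 <= t <= 1 -> S X -> S Y ->
  (phi (L0add (L0scale t X) (L0scale (1 - t) Y))
     <= t%:E * phi X + (1 - t)%:E * phi Y)%E.

Definition proper_on S phi : Prop :=
  (forall X, S X -> (-oo < phi X)%E) /\ (exists2 X, S X & (phi X < +oo)%E).

Definition monotone_on S phi : Prop :=
  forall X Y, S X -> S Y -> L0le X Y -> (phi X <= phi Y)%E.

Definition monotone_convex S phi : Prop :=
  [/\ proper_on S phi, convex_on S phi & monotone_on S phi].

Definition Lebesgue_property S phi : Prop :=
  forall (X_ : nat -> L0) (X Y : L0),
    (forall n, S (X_ n)) -> S Y -> L0le (L0cst P 0) Y ->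
    (forall n, \forall w \ae P, `|X_ n w| <= Y w) ->
    (\forall w \ae P, (fun n => X_ n w) @ \oo --> X w) ->
    (fun n => phi (X_ n)) @ \oo --> phi X.

Definition Lebesgue_extension (phi0 : L0 -> R) phi S : Prop :=
  [/\ solid_space S, Linfty P `<=` S, monotone_convex S phi,
      Lebesgue_property S phi &
      forall X, Linfty P X -> phi X = (phi0 X)%:E].

Definition maximum_Lebesgue_extension (phi0 : L0 -> R) phi S : Prop :=
  Lebesgue_extension phi0 phi S /\
  forall phi' S', Lebesgue_extension phi0 phi' S' ->
    S' `<=` S /\ forall X, S' X -> phi' X = phi X.

(* For solid spaces, containing the constants amounts to containing L^oo. *)
Definition finite_Lebesgue_extension (phi0 : L0 -> R) phi S : Prop :=
  [/\ solid_space S,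
      forall c : R, S (L0cst P c),
      forall X, S X -> phi X \is a fin_num,
      monotone_convex S phi /\ Lebesgue_property S phi &
      forall X, Linfty P X -> phi X = (phi0 X)%:E].

Definition conjugate (phi0 : L0 -> R) (Z : L0) : \bar R :=
  ereal_sup [set ('E_P[(X : T -> R) \* Z] - (phi0 X)%:E)%E | X in Linfty P].

Definition dom_conjugate (phi0 : L0 -> R) : set L0 :=
  [set Z | L1 P Z /\ (conjugate phi0 Z < +oo)%E].

Definition D0 (phi0 : L0 -> R) : set L0 :=
  [set X | forall Z, dom_conjugate phi0 Z ->
             (X : T -> R)^\- \* (Z : T -> R) \in Lfun P 1%E].

(* Meaningful for X in [D0 phi0]: there the negative part of XZ is integrable
   for each Z >= 0 in the domain, so that E[XZ] is the usual extended integral,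
   with values in ]-oo, +oo]. *)
Definition phi_hat (phi0 : L0 -> R) (X : L0) : \bar R :=
  ereal_sup [set ('E_P[(X : T -> R) \* Z] - conjugate phi0 Z)%E
            | Z in dom_conjugate phi0].

Definition M_u (phi0 : L0 -> R) : set L0 :=
  [set X | forall a : R, 0 < a ->
             (fun N => phi_hat phi0 (L0tail a N X)) @ \oo --> 0%E].

End Lebesgue_extensions.

(* Main.v *)
From HB Require Import structures.
Require Import Defs.
From mathcomp Require Import all_boot all_order all_algebra.
From mathcomp Require Import all_classical all_reals all_analysis.
From mathcomp Require Import measurable_realfun.
From mathcomp Require Import ess_sup_inf ring lra.

(** Write dom for the set of densities Z at which the conjugate of phi0 is
    finite.  The argument has three ingredients.

    Duality on L^oo.  At a bounded X0 the finite convex function phi0 has an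
    algebraic subgradient l by the Hahn-Banach theorem
    ([Hahn_Banach_convex]).  Monotonicity makes l positive, and the Lebesgue
    property makes A |-> l(1_A) countably additive, so by Radon-Nikodym l is
    integration against some Z in L^1 ([positive_functional_density],
    [subgradient_exists]).  Hence phi_hat = phi0 on L^oo, with the supremum
    attained ([phi_hat_Linfty]).

    The space M_u.  On the space of all X with XZ in L^1 for every Z in dom,
    phi_hat is a supremum of monotone affine functionals, hence monotone and
    convex.  M_u is the part of that space where the tails |X| 1_{|X|>N} are
    small for phi_hat at every scale.  The domination
    U <= min(U,N) + Y 1_{Y>N} for 0 <= U <= Y ([le_clamp_tail]) splits any U
    into a bounded piece, where phi0 decides, and a tail of Y, which is
    uniformly small.  With convexity it gives finiteness on M_u and
    phi_hat(U_n) -> 0 for dominated U_n -> 0; a convexity argument upgrades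
    this convergence at 0 to the full Lebesgue property
    ([Lebesgue_of_vanishing]).

    Maximality.  Let (phi, S) be an extension.  For nonnegative Y in S,
    truncation and monotone convergence in E[YZ] give phi_hat(Y) <= phi(Y)
    ([phi_hat_le_extension]).  The Lebesgue property of phi sends phi of the
    tails of any X in S to 0, so S is contained in M_u.  Finally phi and
    phi_hat are both the limit of phi0 along the truncations of X, hence
    agree on S. *)

Set Implicit Arguments.
Unset Strict Implicit.
Unset Printing Implicit Defensive.

Import Order.TTheory GRing.Theory Num.Theory.
Import numFieldNormedType.Exports.

Local Open Scope classical_set_scope.
Local Open Scope ring_scope.

(** * Linear minorants of convex functions *)
Section Hahn_Banach.
Context (R : realType) (V : lmodType R).
Implicit Types (p q : V -> R) (x y : V).

Definition convex_fun q := forall (t : R) x y, 0 <= t <= 1 ->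
  q (t *: x + (1 - t) *: y) <= t * q x + (1 - t) * q y.

Lemma le_convex_inf (A B : set R) (t c : R) : 0 <= t <= 1 ->
  has_inf A -> has_inf B ->
  (forall a b, A a -> B b -> c <= t * a + (1 - t) * b) ->
  c <= t * inf A + (1 - t) * inf B.
Proof.
move=> /andP[t0 t1] hA hB cAB; apply/ler_addgt0Pr => e e0.
have [a Aa ale] := inf_adherent e0 hA.
have [b Bb ble] := inf_adherent e0 hB.
have := cAB a b Aa Bb; nra.
Qed.

(** Convexity along the segment from -x to x, whose midpoint is 0.  It bounds
    every convex minorant of p below by one function of p, so infima of chains
    of minorants are finite. *)
Lemma convex_lower_bound p q x : convex_fun q -> q 0 = 0 ->
  (forall y, q y <= p y) -> - p (- x) <= q x.
Proof.
move=> qc q0 qp.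
have h01 : 0 <= (2^-1 : R) <= 1 by apply/andP; split; lra.
have := qc _ x (- x) h01.
have -> : (1 - 2^-1 = 2^-1 :> R) by lra.
rewrite scalerN subrr q0; have := qp (- x); lra.
Qed.

(** Zorn's lemma on the convex minorants of p that vanish at 0: the pointwise
    infimum of a chain is convex, since of two members of a chain one may
    use the smaller at both points. *)
Lemma convex_minimal p : convex_fun p -> p 0 = 0 ->
  exists q, [/\ convex_fun q, q 0 = 0, forall x, q x <= p x &
    forall q', convex_fun q' -> q' 0 = 0 -> (forall x, q' x <= q x) -> q' = q].
Proof.
move=> pc p0.
pose below q := [/\ convex_fun q, q 0 = 0 & forall x, q x <= p x].
pose K := {q : V -> R | below q}.
pose r (q1 q2 : K) := `[< forall x, sval q2 x <= sval q1 x >].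
have [||||[q [qc q0 qp]] qmin] := @Zorn K r.
- by move=> q; apply/asboolP.
- move=> q1 q2 q3 /asboolP h1 /asboolP h2; apply/asboolP => x.
  exact: le_trans (h2 x) (h1 x).
- move=> [q1 h1] [q2 h2] /asboolP/= h12 /asboolP/= h21; apply: eq_exist.
  by apply/funext => x; apply/eqP; rewrite eq_le h12 h21.
- move=> A Atot.
  have [->|/set0P[qA AqA]] := eqVneq A set0.
    by exists (exist below p (And3 pc p0 (fun x => lexx (p x)))).
  pose B x := [set sval q x | q in A].
  have Binf x : has_inf (B x).
    split; first by exists (sval qA x), qA.
    exists (- p (- x)) => _ [[q [qc q0 qp]] Aq <-] /=.
    exact: convex_lower_bound.
  have infB (k : K) x : A k -> inf (B x) <= sval k x.
    by move=> Ak; apply: ge_inf; [case: (Binf x)|exists k].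
  have Bc : convex_fun (fun x => inf (B x)).
    move=> t x y t01; apply: le_convex_inf => //.
    move=> _ _ [q1 Aq1 <-] [q2 Aq2 <-].
    have /andP[t0 t1] := t01.
    wlog q12 : q1 q2 Aq1 Aq2 / r q1 q2.
      move=> wl; have [q12|q21] := Atot _ _ Aq1 Aq2; first exact: wl.
      apply: (le_trans (infB q1 _ Aq1)).
      have [q1c _ _] := svalP q1.
      apply: (le_trans (q1c t x y t01)).
      by rewrite lerD2l ler_wpM2l ?subr_ge0//; exact: (asboolP _ q21 y).
    apply: (le_trans (infB q2 _ Aq2)).
    have [q2c _ _] := svalP q2.
    apply: (le_trans (q2c t x y t01)).
    by rewrite lerD2r ler_wpM2l//; exact: (asboolP _ q12 x).
  have B0 : inf (B 0) = 0.
    rewrite (_ : B 0 = [set 0]) ?inf1//; apply/seteqP; split => [_ [q Aq <-]|_ ->].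
      by have [] := svalP q.
    by exists qA => //; have [] := svalP qA.
  have Bp x : inf (B x) <= p x.
    by apply: (le_trans (infB qA x AqA)); have [] := svalP qA.
  by exists (exist below _ (And3 Bc B0 Bp)) => q Aq; apply/asboolP => x /=; exact: infB.
exists q; split => // q' q'c q'0 q'q.
have q'p x : q' x <= p x by exact: le_trans (q'q x) (qp x).
have := qmin (exist below q' (And3 q'c q'0 q'p)).
by move=> /(_ (asboolT q'q)) /(congr1 sval).
Qed.

(** A minimal convex minorant q is linear, because each failure of linearity
    produces a smaller competitor: x |-> q(a x)/a for 0 < a <= 1 forces
    homogeneity, and then x |-> inf_(t >= 0) (q(x + t y) - t q(y)) forces
    q(x) + q(y) <= q(x + y).  Working with functions defined on the whole
    space avoids the extension of partial functionals. *)
Theorem Hahn_Banach_convex p : convex_fun p -> p 0 = 0 ->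
  exists l : V -> R, [/\ forall x y, l (x + y) = l x + l y,
    forall a x, l (a *: x) = a * l x & forall x, l x <= p x].
Proof.
move=> pc p0; have [q [qc q0 qp qmin]] := convex_minimal pc p0.
have qlb x : - q (- x) <= q x by exact: convex_lower_bound.
(* By convexity between a y and 0, rescaling by a <= 1 lowers q. *)
have homc (a : R) x : 0 < a <= 1 -> q (a *: x) = a * q x.
  move=> /andP[a0 a1].
  suff /(congr1 (fun f => a * f x)) <- : (fun y => a^-1 * q (a *: y)) = q.
    by rewrite mulrA divff ?mul1r// gt_eqF.
  apply: qmin; last 2 first.
    - by rewrite scaler0 q0 mulr0.
    - move=> y; rewrite ler_pdivrMl//.
      have := qc a y 0; rewrite a1 ltW// => /(_ isT).
      by rewrite scaler0 addr0 q0 mulr0 addr0.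
    move=> t y z t01.
    rewrite [X in _ <= X](_ : _ =
      a^-1 * (t * q (a *: y) + (1 - t) * q (a *: z))); last by ring.
    rewrite ler_pM2l ?invr_gt0//.
    rewrite scalerDr !scalerA ![a * _]mulrC -!scalerA.
    exact: qc.
have hom (a : R) x : 0 <= a -> q (a *: x) = a * q x.
  rewrite le_eqVlt => /predU1P[<-|a0]; first by rewrite scale0r q0 mul0r.
  have [a1|a1] := leP a 1; first by rewrite homc// a0.
  have := @homc a^-1 (a *: x); rewrite invr_gt0 a0 invf_le1// (ltW a1).
  rewrite scalerA mulVf ?gt_eqF// scale1r => ->//.
  by rewrite mulrA divff ?mul1r// gt_eqF.
have subadd x y : q (x + y) <= q x + q y.
  have h01 : 0 <= (2^-1 : R) <= 1 by apply/andP; split; lra.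
  have := qc _ (2 *: x) (2 *: y) h01.
  have -> : (1 - 2^-1 = 2^-1 :> R) by lra.
  by rewrite !scalerA mulVf// !scale1r !hom// !mulrA mulVf// !mul1r.
have add x y : q (x + y) = q x + q y.
  apply/eqP; rewrite eq_le subadd/= -lerBrDr.
  pose B z := [set q (z + t *: y) - t * q y | t in [set t : R | 0 <= t]].
  have Binf z : has_inf (B z).
    split; first by exists (q (z + 0 *: y) - 0 * q y), 0 => /=.
    exists (- q (- z)) => _ [t /= t0 <-].
    by have := subadd (z + t *: y) (- z); rewrite addrC addKr hom//; lra.
  have infB z (t : R) : 0 <= t -> inf (B z) <= q (z + t *: y) - t * q y.
    by move=> t0; apply: ge_inf; [case: (Binf z)|exists t].
  suff /(congr1 (fun f => f x)) <- : (fun z => inf (B z)) = q.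
    by have := infB x 1 ler01; rewrite scale1r mul1r.
  apply: qmin.
  - move=> t z w /[dup] t01 /andP[t0 t1]; apply: le_convex_inf => //.
    move=> _ _ [u /= u0 <-] [v /= v0 <-].
    have uv0 : 0 <= t * u + (1 - t) * v by nra.
    apply: (le_trans (infB _ _ uv0)).
    have := qc t (z + u *: y) (w + v *: y) t01.
    rewrite (_ : t *: (z + u *: y) + (1 - t) *: (w + v *: y) =
      t *: z + (1 - t) *: w + (t * u + (1 - t) * v) *: y); first lra.
    by rewrite !scalerDr [(t * u + _) *: y]scalerDl !scalerA addrACA.
  - rewrite (_ : B 0 = [set 0]) ?inf1//.
    apply/seteqP; split => [_ [t /= t0 <-]|_ ->].
      by rewrite add0r hom// subrr.
    by exists 0 => //=; rewrite scale0r addr0 q0 mul0r subrr.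
  - by move=> z; have := infB z 0 (lexx _); rewrite scale0r addr0 mul0r subr0.
have opp x : q (- x) = - q x.
  by apply/eqP; rewrite -subr_eq0 opprK -add addrC subrr q0.
exists q; split => // a x; have [a0|a0] := leP 0 a; first exact: hom.
by rewrite -[a]opprK scaleNr opp hom ?mulNr// oppr_ge0 ltW.
Qed.

End Hahn_Banach.

(** * Almost sure calculus in L^0 *)
Section L0_basics.
Context d (T : measurableType d) (R : realType) (P : probability T R).
Local Notation L0 := {mfun_ P, T >-> R}.
Implicit Types X Y Z : L0.

Lemma L0_eq X Y : (\forall w \ae P, X w = Y w) -> X = Y.
Proof.
move=> XY; rewrite -[X]reprK -[Y]reprK; apply/eqmodP/asboolP.
by apply: filterS XY => w.
Qed.

Lemma L0cstE c : \forall w \ae P, L0cst P c w = c.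
Proof. exact: L0ofE. Qed.

Lemma L0addE X Y : \forall w \ae P, L0add X Y w = X w + Y w.
Proof. exact: L0ofE. Qed.

Lemma L0scaleE a X : \forall w \ae P, L0scale a X w = a * X w.
Proof. exact: L0ofE. Qed.

Lemma L0tailE a N X : \forall w \ae P,
  L0tail a N X w = if N%:R < `|X w| then a * `|X w| else 0.
Proof.
apply: filterS (L0ofE P (measurable_tail_fun a N (measurable_L0 X))) => w ->.
rewrite /tail_fun indicE; case: ifPn => h.
  by rewrite mem_set// mulr1.
by rewrite memNset ?mulr0//; exact/negP.
Qed.

Definition L0abs X : L0 :=
  L0of P (measurableT_comp (@normr_measurable R setT) (measurable_L0 X)).

Lemma L0absE X : \forall w \ae P, L0abs X w = `|X w|.
Proof. exact: L0ofE. Qed.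

Lemma measurable_clamp (c : R) X :
  measurable_fun setT (fun w => Num.max (- c) (Num.min (X w) c)).
Proof.
apply: measurable_maxr => //; apply: measurable_minr => //.
Qed.

Definition L0clamp c X : L0 := L0of P (measurable_clamp c X).

Lemma L0clampE c X :
  \forall w \ae P, L0clamp c X w = Num.max (- c) (Num.min (X w) c).
Proof. exact: L0ofE. Qed.

Lemma clamp_ge0 (c x : R) : 0 <= c -> 0 <= x ->
  Num.max (- c) (Num.min x c) = Num.min x c.
Proof.
by move=> c0 x0; apply/max_idPr; rewrite le_min; lra.
Qed.

Lemma norm_clamp (c x : R) : 0 <= c ->
  `|Num.max (- c) (Num.min x c)| = Num.min `|x| c.
Proof.
move=> c0; have [x0|x0] := leP 0 x.
  by rewrite clamp_ge0// ger0_norm ?ger0_norm// le_min x0.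
rewrite (_ : Num.min x c = x); last by apply/min_idPl; lra.
rewrite (ltr0_norm x0).
have [cx|cx] := leP (- c) x.
  by rewrite ltr0_norm//; apply/esym/min_idPl; lra.
by rewrite normrN ger0_norm//; apply/esym/min_idPr; lra.
Qed.

Lemma Lfun_ooP (f : T -> R) : measurable_fun setT f ->
  f \in Lfun P +oo%E <-> exists M : R, 0 <= M /\ \forall w \ae P, `|f w| <= M.
Proof.
move=> mf; have P0 : (0 < P setT)%E by rewrite probability_setT.
split=> [|[M [M0 fM]]].
  move=> /andP[_]; rewrite inE/= /finite_norm.
  rewrite unlock /Lnorm P0 => /ess_supr_bounded[M fM].
  exists (Num.max M 0); split; first by rewrite le_max lexx orbT.
  by apply: filterS fM => w h; rewrite le_max h.
apply/andP; split; rewrite inE//=.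
rewrite /finite_norm unlock /Lnorm P0.
apply: (@le_lt_trans _ _ M%:E); last exact: ltry.
by apply/ess_supP; apply: filterS fM => w; rewrite /= lee_fin.
Qed.

Lemma LinftyP X :
  Linfty P X <-> exists M : R, 0 <= M /\ \forall w \ae P, `|X w| <= M.
Proof. by rewrite -(Lfun_ooP (measurable_L0 X)). Qed.

Lemma ae_le_integrable (f g : T -> R) : measurable_fun setT f ->
  (\forall w \ae P, `|f w| <= `|g w|) -> P.-integrable setT (EFin \o g) ->
  P.-integrable setT (EFin \o f).
Proof.
move=> mf fg /integrableP[mg gfin]; apply/integrableP; split.
  exact/measurable_EFinP.
apply: le_lt_trans gfin; apply: ae_ge0_le_integral => //.
- by apply: measurableT_comp => //; exact/measurable_EFinP.
- exact: measurableT_comp.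
- by apply: filterS fg => w /= h _; rewrite lee_fin.
Qed.

Lemma Linfty_cst c : Linfty P (L0cst P c).
Proof.
apply/LinftyP; exists `|c|; split=> //.
by apply: filterS (L0cstE c) => w ->.
Qed.

Lemma Linfty_solid : solid_space (Linfty P).
Proof.
split; first split.
- exact: Linfty_cst.
- move=> X Y /LinftyP[M [M0 XM]] /LinftyP[N [N0 YN]]; apply/LinftyP.
  exists (M + N); split; first exact: addr_ge0.
  apply: filterS3 XM YN (L0addE X Y) => w h1 h2 ->.
  by rewrite (le_trans (ler_normD _ _))// lerD.
- move=> a X /LinftyP[M [M0 XM]]; apply/LinftyP.
  exists (`|a| * M); split; first exact: mulr_ge0.
  apply: filterS2 XM (L0scaleE a X) => w h1 ->.
  by rewrite normrM ler_wpM2l.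
- move=> X Y XY /LinftyP[M [M0 YM]]; apply/LinftyP; exists M; split => //.
  by apply: filterS2 XY YM => w; exact: le_trans.
Qed.

Lemma Linfty_clamp X n : Linfty P (L0clamp n%:R X).
Proof.
apply/LinftyP; exists n%:R; split => //.
apply: filterS (L0clampE n%:R X) => w ->.
by rewrite norm_clamp// ge_min lexx orbT.
Qed.

Lemma Lfun1_mul_bounded (f g : T -> R) (M : R) : measurable_fun setT f ->
  (\forall w \ae P, `|f w| <= M) -> g \in Lfun P 1%E -> f \* g \in Lfun P 1%E.
Proof.
move=> mf fM gL1; apply/Lfun1_integrable.
have ig : P.-integrable setT (EFin \o (M \o* g)).
  by apply/Lfun1_integrable; exact: Lfun_scale.
apply: ae_le_integrable ig.
  apply: measurable_funM => //.
  by move: gL1 => /andP[]; rewrite inE.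
apply: filterS fM => w h; rewrite !normrM mulrC ler_wpM2l//.
exact: le_trans h (ler_norm _).
Qed.

Lemma eq_expectation (f g : T -> R) : measurable_fun setT f ->
  measurable_fun setT g -> (\forall w \ae P, f w = g w) ->
  ('E_P[f] = 'E_P[g])%E.
Proof.
move=> mf mg fg; rewrite unlock; apply: ae_eq_integral => //.
- exact/measurable_EFinP.
- exact/measurable_EFinP.
- by apply: filterS fg => w h _; rewrite h.
Qed.

End L0_basics.

(** * Densities of order-continuous positive functionals on L^oo *)
Section representation.
Context d (T : measurableType d) (R : realType) (P : probability T R).
Local Notation Loo := (LfunType P (leey 1%E)).

Lemma Loo_addE (f g : Loo) w : (f + g) w = f w + g w.
Proof. by []. Qed.

Lemma Loo_subE (f g : Loo) w : (f - g) w = f w - g w.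
Proof. by []. Qed.

Lemma Loo_scaleE a (f : Loo) w : (a *: f) w = a * f w.
Proof. by []. Qed.

Lemma Loo_sumE I (s : seq I) (f : I -> Loo) w :
  (\sum_(i <- s) f i) w = \sum_(i <- s) f i w.
Proof.
elim: s => [|i s IH]; first by rewrite !big_nil.
by rewrite !big_cons -IH.
Qed.

Lemma bounded_Lfun_oo (f : T -> R) (M : R) : measurable_fun setT f ->
  (forall w, `|f w| <= M) -> f \in Lfun P +oo%E.
Proof.
move=> mf fM; apply/(Lfun_ooP P mf); exists `|M|; split => //.
by apply: nearW => w; exact: le_trans (fM w) (ler_norm _).
Qed.

(** A measure is a function on all subsets, while the functional only sees
    measurable indicators; nonmeasurable sets are sent to the empty set. *)
Definition measurable_or_empty (A : set T) := if `[< measurable A >] then A else set0.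

Lemma measurable_or_emptyE A : measurable A -> measurable_or_empty A = A.
Proof. by rewrite /measurable_or_empty; case: asboolP. Qed.

Lemma measurable_or_emptyP A : measurable (measurable_or_empty A).
Proof. by rewrite /measurable_or_empty; case: asboolP. Qed.

Lemma indic_Lfun A : (\1_(measurable_or_empty A) : T -> R) \in Lfun P +oo%E.
Proof.
apply: (@bounded_Lfun_oo _ 1); first exact/measurable_indic/measurable_or_emptyP.
by move=> w; rewrite indicE; case: (_ \in _); rewrite ?normr0 ?normr1.
Qed.

Definition Loo_indic A : Loo := Lfun_Sub (leey 1%E) (indic_Lfun A).

Lemma Loo_indicE A w : measurable A -> Loo_indic A w = \1_A w.
Proof. by move=> mA; rewrite -[in RHS](measurable_or_emptyE mA). Qed.

(** Partial sums of indicators of disjoint sets reach 1 at the single index k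
    whose set contains w; this makes the remainders below tend to 0
    everywhere. *)
Lemma sum_indic_trivIset (F : (set T)^nat) w k n : trivIset setT F -> F k w ->
  \sum_(0 <= i < n) (\1_(F i) w : R) = (k < n)%N%:R.
Proof.
move=> tF Fkw; elim: n => [|n IH]; first by rewrite big_nil.
rewrite big_nat_recr//= IH indicE [in RHS]ltnS [in RHS]leq_eqVlt.
have [<-|kn] := eqVneq k n; first by rewrite ltnn add0r mem_set.
rewrite memNset ?addr0// => Fnw.
by move/eqP: kn; apply; apply: tF => //; exists w.
Qed.

Variable l : Loo -> R.
Hypothesis lD : forall f g, l (f + g) = l f + l g.
Hypothesis lZ : forall a f, l (a *: f) = a * l f.
Hypothesis l_ge0 : forall f : Loo, (\forall w \ae P, 0 <= f w) -> 0 <= l f.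
Hypothesis l_cvg0 : forall (g : nat -> Loo) (M : R),
  (forall n w, 0 <= g n w <= M) -> (forall w, g n w @[n --> \oo] --> 0) ->
  l (g n) @[n --> \oo] --> 0.

Let l0 : l 0 = 0.
Proof. by rewrite -(scale0r 0) lZ mul0r. Qed.

Let lB f g : l (f - g) = l f - l g.
Proof. by rewrite lD -scaleN1r lZ mulN1r. Qed.

Let l_sum I (s : seq I) (f : I -> Loo) :
  l (\sum_(i <- s) f i) = \sum_(i <- s) l (f i).
Proof.
elim: s => [|i s IH]; first by rewrite !big_nil l0.
by rewrite !big_cons lD IH.
Qed.

Let functional_ae_eq (f g : Loo) : (\forall w \ae P, f w = g w) -> l f = l g.
Proof.
move=> fg; apply/eqP; rewrite eq_le -subr_ge0 -lB -[X in _ && X]subr_ge0 -lB.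
by apply/andP; split; apply: l_ge0; apply: filterS fg => w fgw;
  rewrite Loo_subE fgw subrr.
Qed.

Definition functional_measure A := (l (Loo_indic A))%:E.

Let nu0 : functional_measure set0 = 0%E.
Proof.
rewrite /functional_measure (_ : Loo_indic set0 = 0) ?l0//; apply/LfuneqP => w.
by rewrite Loo_indicE// indic0.
Qed.

Let nu_ge0 A : (0 <= functional_measure A)%E.
Proof.
by rewrite lee_fin; apply: l_ge0; apply: nearW => w; rewrite /= indicE.
Qed.

(** The remainder of the series is the value of l at
    1_{U F_i} - sum_(i < n) 1_{F_i}, which lies in [0, 1] and tends to 0
    everywhere. *)
Let nu_sigma_additive : semi_sigma_additive functional_measure.
Proof.
move=> F mF tF mUF.
pose g n := Loo_indic (\bigcup_i F i) - \sum_(0 <= i < n) Loo_indic (F i).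
have gE n : l (g n) =
    l (Loo_indic (\bigcup_i F i)) - \sum_(0 <= i < n) l (Loo_indic (F i)).
  by rewrite lB l_sum.
have gkE n k w : F k w -> g n w = 1 - (k < n)%N%:R.
  move=> Fkw; rewrite Loo_subE Loo_sumE Loo_indicE// indicE mem_set; last by exists k.
  rewrite -(sum_indic_trivIset n tF Fkw); congr (_ - _).
  by apply: eq_bigr => i _; rewrite Loo_indicE.
have g0E n w : ~ (\bigcup_i F i) w -> g n w = 0.
  move=> Fw; rewrite Loo_subE Loo_sumE Loo_indicE// indicE memNset// big1 ?subrr//.
  move=> i _; rewrite Loo_indicE// indicE memNset// => Fiw.
  by apply: Fw; exists i.
have g01 n w : 0 <= g n w <= 1.
  have [[k _ Fkw]|Fw] := pselect ((\bigcup_i F i) w); last by rewrite g0E// lexx ler01.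
  by rewrite (gkE _ _ _ Fkw); case: (_ < _)%N; rewrite ?subrr ?subr0 ?lexx ?ler01.
have gcvg w : g n w @[n --> \oo] --> 0.
  have [[k _ Fkw]|Fw] := pselect ((\bigcup_i F i) w); last first.
    by under eq_fun do rewrite g0E//; exact: cvg_cst.
  apply: cvg_near_cst; exists k.+1 => // n kn; have {}kn : (k < n)%N := kn.
  by rewrite (gkE _ _ _ Fkw) kn subrr.
have := l_cvg0 g01 gcvg; under eq_fun do rewrite gE.
move=> h; have : \sum_(0 <= i < n) l (Loo_indic (F i)) @[n --> \oo] -->
    l (Loo_indic (\bigcup_i F i)).
  rewrite -[X in _ --> X]subr0.
  under eq_fun do rewrite -[\sum_(_ <= _ < _) _](subKr (l (Loo_indic (\bigcup_i F i)))).
  by apply: cvgB => //; exact: cvg_cst.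
rewrite /functional_measure; under [X in _ -> X @ _ --> _]eq_fun do rewrite sumEFin.
by move=> h'; apply/cvg_EFin; [exact: nearW|].
Qed.


HB.instance Definition _ := isMeasure.Build d T R functional_measure
  nu0 nu_ge0 nu_sigma_additive.

Let nu_fin : fin_num_fun functional_measure. Proof. by []. Qed.

HB.instance Definition _ := 
  Measure_isFinite.Build d T R functional_measure nu_fin.

Lemma functional_measure_dominated : functional_measure `<< P.
Proof.
apply/null_content_dominatesP => A mA PA0.
suff : l (Loo_indic A) = 0 by rewrite /functional_measure/= => ->.
rewrite -l0; apply: functional_ae_eq; exists A; split=> // w h.
apply: contrapT => nAw; apply: h.
by have := Loo_indicE w mA; rewrite indicE memNset.
Qed.

Import HBNNSimple.

Lemma functional_nnsfunE (h : {nnsfun T >-> R}) (hV : Loo) : (forall w, hV w = h w) ->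
  (\int[functional_measure]_w (h w)%:E = (l hV)%:E)%E.
Proof.
move=> hVE; rewrite integralT_nnsfun sintegralE fsbig_finite//=.
have -> : hV = \sum_(x <- finmap.enum_fset (fset_set (range h))) x *: Loo_indic (h @^-1` [set x]).
  apply/LfuneqP => w; rewrite hVE Loo_sumE fimfunE fsbig_finite//.
  by apply: eq_bigr => x _; rewrite Loo_scaleE Loo_indicE.
by rewrite l_sum -sumEFin; apply: eq_bigr => x _; rewrite lZ EFinM.
Qed.

(** Both sides are continuous along simple functions increasing to f: the
    integral by monotone convergence, and l because f - h_n decreases to 0
    and is bounded. *)
Lemma functional_integralE (f : Loo) (M : R) : (forall w, 0 <= f w <= M) ->
  (\int[functional_measure]_w (f w)%:E = (l f)%:E)%E.
Proof.
move=> fM.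
have f0 w : [set: T] w -> (0 <= (f w)%:E)%E.
  by move=> _; rewrite lee_fin; case/andP: (fM w).
have mf : measurable_fun setT (EFin \o f) by exact/measurable_EFinP.
pose h := nnsfun_approx measurableT mf.
have hf n w : h n w <= f w.
  by rewrite -lee_fin /h nnsfun_approxE; apply: le_approx.
have hM n w : `|h n w| <= M.
  by rewrite ger0_norm// (le_trans (hf n w))//; case/andP: (fM w).
have mh n : measurable_fun setT (h n) by [].
pose hV n : Loo := Lfun_Sub (leey 1%E) (bounded_Lfun_oo (mh n) (hM n)).
have hcvg w : h n w @[n --> \oo] --> f w.
  by have /fine_cvgP[_] := @cvg_nnsfun_approx _ _ _ _ measurableT _ mf f0 w I.
have ifh : (\int[functional_measure]_w (h n w)%:E @[n --> \oo] -->
    \int[functional_measure]_w (f w)%:E)%E.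
  have -> : (\int[functional_measure]_w (f w)%:E =
      \int[functional_measure]_w limn (fun n => (h n w)%:E))%E.
    apply: eq_integral => w _; apply/esym/cvg_lim => //.
    by apply/fine_cvgP; split; [exact: nearW|exact: hcvg].
  apply: cvg_monotone_convergence => //.
  - by move=> n; exact/measurable_EFinP.
  - by move=> n w _; rewrite lee_fin.
  - by move=> w _ m n mn; rewrite lee_fin; exact/lefP/nd_nnsfun_approx.
have lfh : l (f - hV n) @[n --> \oo] --> 0.
  apply: (l_cvg0 (M := M)) => [n w|w].
    rewrite Loo_subE subr_ge0 hf/=; have /andP[_] := fM w.
    by apply: le_trans; rewrite lerBlDr lerDl.
  under eq_fun do rewrite Loo_subE.
  by rewrite -(subrr (f w)); apply: cvgB; [exact: cvg_cst|exact: hcvg].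
have {}lfh : l (hV n) @[n --> \oo] --> l f.
  rewrite -[X in _ --> X]subr0.
  under eq_fun do rewrite -[l _](subKr (l f)) -lB.
  by apply: cvgB => //; exact: cvg_cst.
have hE n : (\int[functional_measure]_w (h n w)%:E = (l (hV n))%:E)%E.
  exact: functional_nnsfunE.
apply: (cvg_unique _ ifh) => //=; under eq_fun do rewrite hE.
by apply/fine_cvgP; split; [exact: nearW|].
Qed.

(** Z is the Radon-Nikodym derivative of A |-> l(1_A).  A general f is only
    essentially bounded, so it is clamped to [-M, M] and shifted to the
    nonnegative function g = clamp(f) + M, which changes l and the expectation
    in the same way. *)
Lemma positive_functional_density : exists Z : {mfun_ P, T >-> R},
  L1 P Z /\ forall f : Loo, 'E_P[(f : T -> R) \* Z]%E = (l f)%:E.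
Proof.
have nuP := functional_measure_dominated.
pose D := Radon_Nikodym (charge_of_finite_measure functional_measure) P.
have iD : P.-integrable setT D by exact: Radon_Nikodym_integrable.
have Dfin w : D w \is a fin_num by exact: Radon_Nikodym_fin_num.
have mD : measurable_fun setT (fine \o D).
  by apply: measurableT_comp => //; exact: measurable_int iD.
pose Z := L0of P mD.
have ZD : \forall w \ae P, (Z w)%:E = D w.
  by apply: filterS (L0ofE P mD) => w ->; rewrite /= fineK.
have mZ : measurable_fun setT Z by exact: measurable_L0.
have LZ : L1 P Z.
  apply/Lfun1_integrable; apply: (@ae_le_integrable _ _ _ _ _ (fine \o D)) => //.
    by apply: filterS (L0ofE P mD) => w ->.
  by apply: eq_integrable iD => // w _; rewrite /= fineK.
have mL (f : Loo) : measurable_fun setT f by [].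
have bnd (f : Loo) : exists M : R, 0 <= M /\ \forall w \ae P, `|f w| <= M.
  by apply/(Lfun_ooP P (mL f)); exact: LfunP.
have LfZ (f : Loo) : (f : T -> R) \* Z \in Lfun P 1%E.
  by have [M [_ fM]] := bnd f; exact: Lfun1_mul_bounded fM LZ.
exists Z; split => // f.
have nonneg (g : Loo) M : (forall w, 0 <= g w <= M) ->
    ('E_P[(g : T -> R) \* Z] = (l g)%:E)%E.
  move=> gM; rewrite -(functional_integralE gM).
  rewrite -(@Radon_Nikodym_change_of_variables _ _ _ _ P nuP)//; last first.
    apply: measurable_bounded_integrable => //.
      by rewrite ltey_eq nu_fin.
    exists M; split; first exact: num_real.
    move=> x Mx w _ /=; have /andP[g0 gM'] := gM w.
    by rewrite ger0_norm// (le_trans gM')// ltW.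
  rewrite unlock; apply: ae_eq_integral => //.
  - by apply/measurable_EFinP; exact: measurable_funM.
  - apply: emeasurable_funM; first exact/measurable_EFinP.
    exact: measurable_int iD.
  - by apply: filterS ZD => w h _; rewrite EFinM h.
have [M [M0 fM]] := bnd f.
have mg : measurable_fun setT (fun w => Num.max (- M) (Num.min (f w) M) + M).
  apply: measurable_funD => //.
  by apply: measurable_maxr => //; exact: measurable_minr.
have g0M w : 0 <= Num.max (- M) (Num.min (f w) M) + M <= M + M.
  by rewrite -lerBlDr sub0r le_max lexx/= lerD2r ge_max ge_min lexx orbT; lra.
have gM w : `|Num.max (- M) (Num.min (f w) M) + M| <= M + M.
  by have /andP[h1 h2] := g0M w; rewrite ger0_norm.
pose g : Loo := Lfun_Sub (leey 1%E) (bounded_Lfun_oo mg gM).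
have cM (w : T) : `|cst M w| <= M by rewrite /= ger0_norm.
pose c : Loo := Lfun_Sub (leey 1%E) (bounded_Lfun_oo (measurable_cst M) cM).
have fgc : \forall w \ae P, f w = (g - c) w.
  apply: filterS fM => w; rewrite ler_norml => /andP[f1 f2].
  by rewrite Loo_subE /= addrK (min_idPl f2); apply/esym/max_idPr.
rewrite (functional_ae_eq fgc) lB EFinB -(nonneg g _ g0M).
rewrite -(nonneg c M); last by move=> w; rewrite /= M0 lexx.
rewrite -expectationB//; apply: eq_expectation.
- exact: measurable_funM.
- by apply: measurable_funB; exact: measurable_funM.
- apply: filterS fgc => w h.
  by have := congr1 (fun x => x * Z w) h; rewrite Loo_subE mulrBl.
Qed.

End representation.

(** * Subgradients of phi0 at bounded random variables *)
Section subgradient.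
Context d (T : measurableType d) (R : realType) (P : probability T R).
Local Notation L0 := {mfun_ P, T >-> R}.
Local Notation Loo := (LfunType P (leey 1%E)).
Variable phi0 : L0 -> R.
Hypothesis phi0_mc : monotone_convex (Linfty P) (fun X => (phi0 X)%:E).
Hypothesis phi0_Leb : Lebesgue_property (Linfty P) (fun X => (phi0 X)%:E).

Let phi0_convex (t : R) (X Y : L0) : 0 <= t <= 1 -> Linfty P X -> Linfty P Y ->
  phi0 (L0add (L0scale t X) (L0scale (1 - t) Y)) <= t * phi0 X + (1 - t) * phi0 Y.
Proof. by case: phi0_mc => _ c _ t01 LX LY; have := c t X Y t01 LX LY. Qed.

Let phi0_mono (X Y : L0) : Linfty P X -> Linfty P Y -> L0le X Y ->
  phi0 X <= phi0 Y.
Proof. by case: phi0_mc => _ _ m LX LY XY; have := m X Y LX LY XY. Qed.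

Lemma measurable_Loo (f : Loo) : measurable_fun setT f.
Proof. by []. Qed.

Definition Loo_class (f : Loo) : L0 := L0of P (measurable_Loo f).

Lemma Loo_classE f : \forall w \ae P, Loo_class f w = f w.
Proof. exact: L0ofE. Qed.

Lemma Linfty_class f : Linfty P (Loo_class f).
Proof.
have /(Lfun_ooP P (measurable_Loo f))[M [M0 fM]] := LfunP f.
apply/LinftyP; exists M; split => //.
by apply: filterS2 fM (Loo_classE f) => w h ->.
Qed.

Lemma Linfty_translate X f : Linfty P X -> Linfty P (L0add X (Loo_class f)).
Proof.
have [[_ LD _] _] := Linfty_solid P.
by move=> LX; apply: LD => //; exact: Linfty_class.
Qed.

(** The linear minorant l of h |-> phi0(X0 + h) - phi0(X0) inherits from phi0
    what is needed to have a density: l(-f) <= 0 for f >= 0 by monotonicity,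
    and 0 <= l(g_n) <= phi0(X0 + g_n) - phi0(X0), which tends to 0 by the
    Lebesgue property when g_n -> 0 boundedly. *)
Theorem subgradient_exists X0 : Linfty P X0 -> exists2 Z : L0, L1 P Z &
  forall X, Linfty P X ->
  ('E_P[(X : T -> R) \* Z] - (phi0 X)%:E <=
   'E_P[(X0 : T -> R) \* Z] - (phi0 X0)%:E)%E.
Proof.
move=> LX0.
pose p (f : Loo) := phi0 (L0add X0 (Loo_class f)) - phi0 X0.
have LT f := Linfty_translate f LX0.
have p_convex : convex_fun p.
  move=> t f g t01; rewrite /p.
  have -> : L0add X0 (Loo_class (t *: f + (1 - t) *: g)) =
      L0add (L0scale t (L0add X0 (Loo_class f)))
            (L0scale (1 - t) (L0add X0 (Loo_class g))).
    apply: L0_eq.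
    apply: (filter_app _ _ (L0addE X0 (Loo_class (t *: f + (1 - t) *: g)))).
    apply: (filter_app _ _ (L0addE (L0scale t (L0add X0 (Loo_class f)))
            (L0scale (1 - t) (L0add X0 (Loo_class g))))).
    apply: (filter_app _ _ (L0scaleE t (L0add X0 (Loo_class f)))).
    apply: (filter_app _ _ (L0scaleE (1 - t) (L0add X0 (Loo_class g)))).
    apply: (filter_app _ _ (L0addE X0 (Loo_class f))).
    apply: (filter_app _ _ (L0addE X0 (Loo_class g))).
    apply: (filter_app _ _ (Loo_classE f)).
    apply: (filter_app _ _ (Loo_classE g)).
    apply: filterS (Loo_classE (t *: f + (1 - t) *: g)).
    move=> w hc hg hf hXg hXf hs1 hs2 ha ->.
    by rewrite ha hs1 hs2 hXf hXg hc hg hf Loo_addE !Loo_scaleE; lra.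
  by have := phi0_convex t01 (LT f) (LT g); lra.
have p0 : p 0 = 0.
  rewrite /p (_ : L0add _ _ = X0) ?subrr//; apply: L0_eq.
  apply: filterS2 (L0addE X0 (Loo_class 0)) (Loo_classE 0) => w -> ->.
  by rewrite addr0.
have [l [lD lZ lp]] := Hahn_Banach_convex p_convex p0.
have l_opp f : l (- f) = - l f by rewrite -scaleN1r lZ mulN1r.
have l_ge0 (f : Loo) : (\forall w \ae P, 0 <= f w) -> 0 <= l f.
  move=> f0; rewrite -oppr_le0 -l_opp; apply: (le_trans (lp _)).
  rewrite /p subr_le0; apply: phi0_mono => //.
  apply: filterS3 (L0addE X0 (Loo_class (- f))) (Loo_classE (- f)) f0 => w -> -> h.
  by rewrite -subr_ge0 opprD addNKr opprK.
have l_cvg0 (g : nat -> Loo) (M : R) : (forall n w, 0 <= g n w <= M) ->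
    (forall w, g n w @[n --> \oo] --> 0) -> l (g n) @[n --> \oo] --> 0.
  move=> gM g0.
  have lp0 : p (g n) @[n --> \oo] --> 0.
    rewrite /p -[X in _ --> X](subrr (phi0 X0)).
    apply: cvgB; last exact: cvg_cst.
    have [[_ LDD _] _] := Linfty_solid P.
    have LY : Linfty P (L0add (L0abs X0) (L0cst P M)).
      apply: LDD; last exact: Linfty_cst.
      have /LinftyP[N [N0 X0N]] := LX0; apply/LinftyP; exists N; split => //.
      by apply: filterS2 X0N (L0absE X0) => w h ->; rewrite normr_id.
    have YE : \forall w \ae P, L0add (L0abs X0) (L0cst P M) w = `|X0 w| + M.
      apply: filterS3 (L0addE (L0abs X0) (L0cst P M)) (L0absE X0) (L0cstE P M).
      by move=> w -> -> ->.
    have M0 : 0 <= M by have /andP[] := gM 0%N point; exact: le_trans.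
    have Xg n w : L0add X0 (Loo_class (g n)) w = X0 w + g n w ->
        `|L0add X0 (Loo_class (g n)) w| <= `|X0 w| + M.
      move=> ->; have /andP[h1 h2] := gM n w.
      by rewrite (le_trans (ler_normD _ _))// lerD2l ger0_norm.
    have XgE n : \forall w \ae P, L0add X0 (Loo_class (g n)) w = X0 w + g n w.
      apply: filterS2 (L0addE X0 (Loo_class (g n))) (Loo_classE (g n)).
      by move=> w -> ->.
    have := phi0_Leb (X_ := fun n => L0add X0 (Loo_class (g n))) (X := X0)
      (fun n => LT (g n)) LY.
    case/(_ _ _ _)/fine_cvgP => //.
    - apply: filterS2 YE (L0cstE P 0) => w -> ->.
      exact: addr_ge0.
    - by move=> n; apply: filterS2 YE (XgE n) => w ->; exact: Xg.
    - apply: filterS (ae_foralln XgE) => w h; rewrite (_ : (fun n => _) =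
        (fun n => X0 w + g n w)); last by apply/funext => n; rewrite h.
      by have := cvgD (cvg_cst (X0 w)) (g0 w); rewrite addr0; apply.
  apply: (squeeze_cvgr _ (cvg_cst 0) lp0); apply: nearW => n.
  rewrite lp andbT; apply: l_ge0; apply: nearW => w.
  by have /andP[] := gM n w.
have [Z [LZ ZE]] := positive_functional_density lD lZ l_ge0 l_cvg0.
exists Z => // X LX.
have mZ : measurable_fun setT Z by exact: measurable_L0.
have mXX0 : measurable_fun setT ((X : T -> R) \- X0).
  by apply: measurable_funB; exact: measurable_L0.
have [M [M0 XM]] := (LinftyP X).1 LX.
have [N [N0 X0N]] := (LinftyP X0).1 LX0.
have LXX0 : (X : T -> R) \- X0 \in Lfun P +oo%E.
  apply/(Lfun_ooP P mXX0); exists (M + N); split; first exact: addr_ge0.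
  apply: filterS2 XM X0N => w h1 h2.
  by rewrite (le_trans (ler_normB _ _))// lerD.
pose f : Loo := Lfun_Sub (leey 1%E) LXX0.
have XE : L0add X0 (Loo_class f) = X.
  apply: L0_eq; apply: filterS2 (L0addE X0 (Loo_class f)) (Loo_classE f) => w -> ->.
  by rewrite /= subrKC.
have LXZ : (X : T -> R) \* Z \in Lfun P 1%E.
  exact: Lfun1_mul_bounded (measurable_L0 X) XM LZ.
have LX0Z : (X0 : T -> R) \* Z \in Lfun P 1%E.
  exact: Lfun1_mul_bounded (measurable_L0 X0) X0N LZ.
have : ('E_P[(X : T -> R) \* Z] - 'E_P[(X0 : T -> R) \* Z] <=
    (phi0 X - phi0 X0)%:E)%E.
  rewrite -expectationB//.
  rewrite (_ : _ \- _ = (f : T -> R) \* Z); last first.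
    by apply/funext => w; rewrite /= mulrBl.
  by rewrite ZE lee_fin (le_trans (lp f))// /p XE.
rewrite -(fineK (expectation_fin_num LXZ)) -(fineK (expectation_fin_num LX0Z)).
by rewrite -!EFinB !lee_fin; lra.
Qed.

End subgradient.

(** * The pairing of L^0 with densities *)
Section pairing.
Context d (T : measurableType d) (R : realType) (P : probability T R).
Local Notation L0 := {mfun_ P, T >-> R}.
Implicit Types X Y Z : L0.

Definition pairing X Z : R := fine ('E_P[(X : T -> R) \* Z])%E.

Lemma pairingE X Z : (X : T -> R) \* Z \in Lfun P 1%E ->
  ('E_P[(X : T -> R) \* Z])%E = (pairing X Z)%:E.
Proof. by move=> XZ; rewrite fineK// expectation_fin_num. Qed.

Lemma measurable_L0M X Z : measurable_fun setT ((X : T -> R) \* Z).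
Proof. by apply: measurable_funM; exact: measurable_L0. Qed.

Lemma pairingD X Y Z :
  (X : T -> R) \* Z \in Lfun P 1%E -> (Y : T -> R) \* Z \in Lfun P 1%E ->
  pairing (L0add X Y) Z = pairing X Z + pairing Y Z.
Proof.
move=> XZ YZ; rewrite /pairing -fineD ?expectation_fin_num//.
rewrite -expectationD//; congr fine; apply: eq_expectation.
- exact: measurable_L0M.
- by apply: measurable_funD; exact: measurable_L0M.
- by apply: filterS (L0addE X Y) => w /= ->; rewrite mulrDl.
Qed.

Lemma pairingZ a X Z : (X : T -> R) \* Z \in Lfun P 1%E ->
  pairing (L0scale a X) Z = a * pairing X Z.
Proof.
move=> XZ; rewrite /pairing -[RHS]/(fine a%:E * _) -fineM ?expectation_fin_num//.
rewrite -expectationZl//; congr fine; apply: eq_expectation.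
- exact: measurable_L0M.
- by apply: measurable_funM => //; exact: measurable_L0M.
- by apply: filterS (L0scaleE a X) => w /= ->; ring.
Qed.

Lemma le_pairing X Y Z : (\forall w \ae P, 0 <= Z w) -> L0le X Y ->
  (X : T -> R) \* Z \in Lfun P 1%E -> (Y : T -> R) \* Z \in Lfun P 1%E ->
  pairing X Z <= pairing Y Z.
Proof.
move=> Z0 XY XZ YZ; rewrite -lee_fin -!pairingE// -sube_ge0; last first.
  by rewrite expectation_fin_num// orbT.
rewrite -expectationB//.
set D := _ \- _.
have mD : measurable_fun setT D by apply: measurable_funB; exact: measurable_L0M.
(* D is nonnegative only up to a null set; its positive part is so everywhere. *)
pose D' w := Num.max 0 (D w).
have -> : ('E_P[D] = 'E_P[D'])%E.
  apply: eq_expectation => //; first exact: measurable_maxr.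
  apply: filterS2 Z0 XY => w z0 xy; apply/esym/max_idPr.
  by rewrite subr_ge0 ler_wpM2r.
by apply: expectation_ge0 => w; rewrite le_max lexx.
Qed.

Lemma Lfun1_pairing_dominated X Y Z : (\forall w \ae P, `|X w| <= `|Y w|) ->
  (Y : T -> R) \* Z \in Lfun P 1%E -> (X : T -> R) \* Z \in Lfun P 1%E.
Proof.
move=> XY /Lfun1_integrable YZ; apply/Lfun1_integrable.
apply: ae_le_integrable YZ; first exact: measurable_L0M.
by apply: filterS XY => w h; rewrite !normrM ler_wpM2r.
Qed.

End pairing.

(** * The dual representation on L^oo and its extension *)
Section dual_representation.
Context d (T : measurableType d) (R : realType) (P : probability T R).
Local Notation L0 := {mfun_ P, T >-> R}.
Implicit Types X Y Z : L0.
Variable phi0 : L0 -> R.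
Hypothesis phi0_mc : monotone_convex (Linfty P) (fun X => (phi0 X)%:E).
Hypothesis phi0_Leb : Lebesgue_property (Linfty P) (fun X => (phi0 X)%:E).
Hypothesis phi0_0 : phi0 (L0cst P 0) = 0.

Local Notation dom := (dom_conjugate phi0).
Local Notation conj := (conjugate phi0).

Lemma Lfun1_Linfty X Z : Linfty P X -> L1 P Z -> (X : T -> R) \* Z \in Lfun P 1%E.
Proof.
by move=> /LinftyP[M [_ XM]] LZ; exact: Lfun1_mul_bounded (measurable_L0 X) XM LZ.
Qed.

Lemma conjugate_ge X Z : Linfty P X -> L1 P Z ->
  ((pairing X Z - phi0 X)%:E <= conj Z)%E.
Proof.
move=> LX LZ; rewrite EFinB -pairingE; last exact: Lfun1_Linfty.
by apply: ereal_sup_ubound; exists X.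
Qed.

Lemma pairing0 Z : pairing (L0cst P 0) Z = 0.
Proof.
rewrite /pairing; suff -> : ('E_P[(L0cst P 0 : T -> R) \* Z])%E = 0%E by [].
rewrite -[RHS](expectation_cst P 0).
apply: eq_expectation => //.
by apply: filterS (L0cstE P 0) => w /= ->; rewrite mul0r.
Qed.

Lemma conjugate_ge0 Z : L1 P Z -> (0 <= conj Z)%E.
Proof.
by move/(conjugate_ge (Linfty_cst P 0)); rewrite pairing0 phi0_0 subr0.
Qed.

Lemma conjugate_fin_num Z : dom Z -> conj Z \is a fin_num.
Proof. by move=> [LZ Zoo]; rewrite ge0_fin_numE// conjugate_ge0. Qed.

(** Testing the conjugate at -n 1_{Z < 0} <= 0 gives
    n E[Z^-] <= conjugate(Z) + phi0(0) for all n, so E[Z^-] = 0. *)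
Lemma dom_ge0 Z : dom Z -> \forall w \ae P, 0 <= Z w.
Proof.
move=> domZ; have [LZ _] := domZ.
have mZ : measurable_fun setT Z by exact: measurable_L0.
have mA : measurable [set w | Z w < 0].
  rewrite (_ : [set w | _] = (Z : T -> R) @^-1` `]-oo, 0[); last first.
    by apply/seteqP; split => w /=; rewrite in_itv.
  by rewrite -[X in measurable X]setTI; exact: mZ.
have mB : measurable_fun setT (fun w => - (\1_[set w | Z w < 0] w : R)).
  by apply: measurableT_comp => //; exact: measurable_indic.
pose B := L0of P mB.
have LB : Linfty P B.
  apply/LinftyP; exists 1; split => //.
  apply: filterS (L0ofE P mB) => w ->; rewrite normrN indicE.
  by case: (_ \in _); rewrite ?normr0 ?normr1.
have BZE : \forall w \ae P, B w * Z w = Num.max 0 (- Z w).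
  apply: filterS (L0ofE P mB) => w ->; rewrite indicE mulNr.
  have [Z0|Z0] := ltP (Z w) 0.
    by rewrite mem_set// mul1r; apply/esym/max_idPr; rewrite oppr_ge0 ltW.
  rewrite memNset ?mul0r ?oppr0; last by rewrite /= ltNge Z0.
  by apply/esym/max_idPl; rewrite oppr_le0.
have BZ_le0 : pairing B Z <= 0.
  have [[_ _ LS] _] := Linfty_solid P.
  have nb n : n%:R * pairing B Z <= fine (conj Z).
    have LnB : Linfty P (L0scale n%:R B) by exact: LS.
    have := conjugate_ge LnB LZ.
    rewrite -{1}(fineK (conjugate_fin_num domZ)) lee_fin pairingZ; last first.
      exact: Lfun1_Linfty.
    have : phi0 (L0scale n%:R B) <= 0.
      rewrite -phi0_0 -lee_fin; case: phi0_mc => _ _; apply => //.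
        exact: Linfty_cst.
      apply: filterS3 (L0scaleE n%:R B) (L0ofE P mB) (L0cstE P 0) => w -> -> ->.
      by rewrite mulrN oppr_le0 mulr_ge0// indicE.
    lra.
  rewrite leNgt; apply/negP => b0.
  have := nb (Num.bound `|fine (conj Z) / pairing B Z|).
  rewrite leNgt -ltr_pdivrMr// => /negP; apply.
  by apply: (le_lt_trans (ler_norm _)); exact: archi_boundP.
have mBZ : measurable_fun setT ((B : T -> R) \* Z) by exact: measurable_L0M.
have : (\int[P]_w `|((B : T -> R) \* Z) w|%:E = 0)%E.
  apply/eqP; rewrite eq_le integral_ge0// andbT.
  rewrite (_ : \int[P]_w _ = 'E_P[(B : T -> R) \* Z])%E; last first.
    rewrite unlock; apply: ae_eq_integral => //.
    - by apply/measurable_EFinP; exact: measurableT_comp.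
    - exact/measurable_EFinP.
    - apply: filterS BZE => w /= -> _; rewrite ger0_norm// le_max lexx//.
  by rewrite pairingE ?lee_fin//; exact: Lfun1_Linfty.
have /(ae_eq_integral_abs P measurableT)/[apply] : measurable_fun setT
  (EFin \o ((B : T -> R) \* Z)) by exact/measurable_EFinP.
move=> h; apply: filterS2 h BZE => w /(_ I)/= [->] h.
by rewrite -oppr_le0 h le_max lexx orbT.
Qed.

(** The elements for which all expectations in phi_hat are finite.  It is
    smaller than D0, but it is a solid space that contains M_u, and there
    phi_hat is a supremum of real affine functions. *)
Definition dom_integrable : set L0 :=
  [set X | forall Z, dom Z -> (X : T -> R) \* Z \in Lfun P 1%E].

Lemma Linfty_dom_integrable : Linfty P `<=` dom_integrable.
Proof. by move=> X LX Z [LZ _]; exact: Lfun1_Linfty. Qed.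

Lemma dom_integrable_solid : solid_space dom_integrable.
Proof.
split; first split.
- by apply: Linfty_dom_integrable; exact: Linfty_cst.
- move=> X Y IX IY Z dZ; apply/Lfun1_integrable.
  have := integrableD measurableT ((Lfun1_integrable _ _).1 (IX Z dZ))
     ((Lfun1_integrable _ _).1 (IY Z dZ)).
  apply: (@ae_le_integrable _ _ _ _ _ (((X : T -> R) \* Z) \+ ((Y : T -> R) \* Z))).
    exact: measurable_L0M.
  by apply: filterS (L0addE X Y) => w /= ->; rewrite mulrDl.
- move=> a X IX Z dZ; have := Lfun_scale a (lexx 1) (IX Z dZ).
  move=> /Lfun1_integrable h; apply/Lfun1_integrable; apply: ae_le_integrable h.
    exact: measurable_L0M.
  by apply: filterS (L0scaleE a X) => w /= ->; rewrite -mulrA mulrC.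
- by move=> X Y XY IY Z dZ; exact: Lfun1_pairing_dominated XY (IY Z dZ).
Qed.

Lemma phi_hat_ge X Z : dom_integrable X -> dom Z ->
  ((pairing X Z - fine (conj Z))%:E <= phi_hat phi0 X)%E.
Proof.
move=> IX dZ; rewrite EFinB -pairingE ?fineK ?conjugate_fin_num//; last exact: IX.
by apply: ereal_sup_ubound; exists Z.
Qed.

Lemma phi_hat_le X (c : \bar R) : dom_integrable X ->
  (forall Z, dom Z -> ((pairing X Z - fine (conj Z))%:E <= c)%E) ->
  (phi_hat phi0 X <= c)%E.
Proof.
move=> IX h; apply: ub_ereal_sup => _ [Z dZ <-]; have := h Z dZ.
by rewrite EFinB -pairingE ?fineK ?conjugate_fin_num//; exact: IX.
Qed.

Lemma phi_hat_mono : monotone_on dom_integrable (phi_hat phi0).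
Proof.
move=> X Y IX IY XY; apply: phi_hat_le => // Z dZ.
apply: le_trans (phi_hat_ge IY dZ); rewrite lee_fin lerD2r.
by apply: le_pairing => //; [exact: dom_ge0|exact: IX|exact: IY].
Qed.

Lemma phi_hat_convex : convex_on dom_integrable (phi_hat phi0).
Proof.
have [[_ ID IZ] _] := dom_integrable_solid.
move=> t X Y /andP[t0 t1] IX IY; have s0 : 0 <= 1 - t by rewrite subr_ge0.
apply: phi_hat_le => [|Z dZ].
  by apply: ID; exact: IZ.
have [pX pY] := (IX Z dZ, IY Z dZ).
have [pX' pY'] := (IZ t X IX Z dZ, IZ (1 - t) Y IY Z dZ).
rewrite pairingD// !pairingZ//.
rewrite (_ : (_ - _)%:E = t%:E * (pairing X Z - fine (conj Z))%:E +
  (1 - t)%:E * (pairing Y Z - fine (conj Z))%:E)%E; last first.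
  by rewrite -!EFinM -EFinD; congr EFin; lra.
by apply: leeD; apply: lee_wpmul2l; rewrite ?lee_fin//; exact: phi_hat_ge.
Qed.

(** The inequality <= is the Fenchel inequality; >= is attained at a
    subgradient of phi0 at X. *)
Lemma phi_hat_Linfty X : Linfty P X -> phi_hat phi0 X = (phi0 X)%:E.
Proof.
move=> LX; apply/eqP; rewrite eq_le; apply/andP; split.
  apply: phi_hat_le => [|Z dZ]; first exact: Linfty_dom_integrable.
  have [LZ _] := dZ; have := conjugate_ge LX LZ.
  by rewrite -(fineK (conjugate_fin_num dZ)) !lee_fin; lra.
have [Z LZ hZ] := subgradient_exists phi0_mc phi0_Leb LX.
have cZ : (conj Z <= (pairing X Z - phi0 X)%:E)%E.
  apply: ub_ereal_sup => _ [Y LY <-].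
  by rewrite EFinB -pairingE ?hZ//; exact: Lfun1_Linfty.
have dZ : dom Z by split => //; apply: le_lt_trans cZ _; exact: ltry.
apply: le_trans (phi_hat_ge (Linfty_dom_integrable LX) dZ).
by move: cZ; rewrite -{1}(fineK (conjugate_fin_num dZ)) !lee_fin; lra.
Qed.

Lemma phi_hat_0 : phi_hat phi0 (L0cst P 0) = 0%E.
Proof. by rewrite phi_hat_Linfty ?phi0_0//; exact: Linfty_cst. Qed.

(** An empty supremum would make phi_hat identically -oo, against its value 0
    at 0. *)
Lemma dom_nonempty : dom !=set0.
Proof.
apply/set0P/negP => /eqP d0; have := phi_hat_0.
by rewrite /phi_hat d0 image_set0 ereal_sup0.
Qed.

End dual_representation.

(** * Monotone convex functions and the Lebesgue property *)
Lemma cvge_finP (R : realType) (u : (\bar R)^nat) (l : R) :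
  u @ \oo --> l%:E <-> forall e : R, 0 < e ->
    \forall n \near \oo, ((l - e)%:E <= u n <= (l + e)%:E)%E.
Proof.
split=> [/fine_cvgP[ufin ul] e e0|h].
  move/cvgrPdist_le : ul => /(_ e e0) ul.
  apply: filterS2 ufin ul => n ufin /=; rewrite ler_distl => /andP[h1 h2].
  by rewrite -(fineK ufin) !lee_fin; apply/andP; split; lra.
apply/fine_cvgP; split.
  apply: filterS (h 1 ltr01) => n /andP[h1 h2].
  by rewrite fin_numE -ltNye -ltey (lt_le_trans (ltNyr _) h1) (le_lt_trans h2)// ltry.
apply/cvgrPdist_le => e e0; apply: filterS (h e e0) => n /andP[h1 h2].
have ufin : u n \is a fin_num.
  by rewrite fin_numE -ltNye -ltey (lt_le_trans (ltNyr _) h1) (le_lt_trans h2)// ltry.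
move: h1 h2; rewrite -(fineK ufin) !lee_fin/= => h1 h2.
by rewrite ler_distl; apply/andP; split; lra.
Qed.

Lemma lee_half_sum (R : realType) (a b : \bar R) (e : R) :
  (a <= e%:E)%E -> (b <= e%:E)%E -> (2^-1%:E * a + 2^-1%:E * b <= e%:E)%E.
Proof.
move=> ae be; rewrite (_ : e%:E = (2^-1%:E * e%:E + 2^-1%:E * e%:E)%E).
  by apply: leeD; apply: lee_wpmul2l; rewrite ?lee_fin.
by rewrite -EFinM -EFinD; congr EFin; lra.
Qed.

Section Lebesgue_criterion.
Context d (T : measurableType d) (R : realType) (P : probability T R).
Local Notation L0 := {mfun_ P, T >-> R}.
Variables (S : set L0) (phi : L0 -> \bar R).
Hypothesis S_solid : solid_space S.
Hypothesis phi_convex : convex_on S phi.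
Hypothesis phi_mono : monotone_on S phi.
Implicit Types X Y U : L0.

Lemma solid_abs X : S X -> S (L0abs X).
Proof.
case: S_solid => _ sol; apply: sol; apply: filterS (L0absE X) => w ->.
by rewrite normr_id.
Qed.

Lemma solid_clamp c X : 0 <= c -> S X -> S (L0clamp c X).
Proof.
move=> c0; case: S_solid => _ sol; apply: sol; apply: filterS (L0clampE c X) => w ->.
by rewrite norm_clamp// ge_min lexx.
Qed.

Lemma solid_tail a N X : S X -> S (L0tail a N X).
Proof.
case: S_solid => -[_ _ SZ] sol SX; apply: (sol _ (L0scale a X)); last exact: SZ.
apply: filterS2 (L0tailE a N X) (L0scaleE a X) => w -> ->.
by case: ifP => _; rewrite ?normr0// !normrM normr_id.
Qed.

Lemma Lebesgue_clamp_cvg (psi : L0 -> \bar R) X : Lebesgue_property S psi ->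
  S X -> (fun n => psi (L0clamp n%:R X)) @ \oo --> psi X.
Proof.
move=> Leb SX; apply: (Leb _ _ (L0abs X)).
- by move=> n; exact: solid_clamp.
- exact: solid_abs.
- by apply: filterS2 (L0cstE P 0) (L0absE X) => w -> ->.
- move=> n; apply: filterS2 (L0absE X) (L0clampE n%:R X) => w -> ->.
  by rewrite norm_clamp// ge_min lexx.
- apply: filterS (ae_foralln (fun n => L0clampE n%:R X)) => w h.
  apply: cvg_near_cst; exists (Num.bound `|X w|) => // n hn.
  have {}hn : `|X w| <= n%:R.
    by rewrite ltW// (lt_le_trans (archi_boundP (normr_ge0 _)))// ler_nat.
  move: hn; rewrite h ler_norml => /andP[h1 h2].
  by rewrite (min_idPl h2); apply/max_idPr.
Qed.

Lemma mono_convex_le (t : R) X Y W : 0 <= t <= 1 -> S X -> S Y -> S W ->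
  (\forall w \ae P, W w <= t * X w + (1 - t) * Y w) ->
  (phi W <= t%:E * phi X + (1 - t)%:E * phi Y)%E.
Proof.
move=> t01 SX SY SW WXY; have [[_ SD SZ] _] := S_solid.
apply: le_trans (phi_convex t01 SX SY); apply: phi_mono => //.
  by apply: SD; exact: SZ.
apply: (filter_app _ _ (L0addE (L0scale t X) (L0scale (1 - t) Y))).
by apply: filterS3 WXY (L0scaleE t X) (L0scaleE (1 - t) Y) => w h h1 h2 ->; rewrite h1 h2.
Qed.

Lemma mono_convex_half X Y W : S X -> S Y -> S W ->
  (\forall w \ae P, W w <= X w + Y w) ->
  (phi W <= 2^-1%:E * phi (L0scale 2 X) + 2^-1%:E * phi (L0scale 2 Y))%E.
Proof.
move=> SX SY SW WXY; have [[_ _ SZ] _] := S_solid.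
have h01 : 0 <= (2^-1 : R) <= 1 by apply/andP; split; lra.
have half : 1 - 2^-1 = 2^-1 :> R by lra.
have := @mono_convex_le (2^-1) (L0scale 2 X) (L0scale 2 Y) W h01 (SZ _ _ SX)
  (SZ _ _ SY) SW.
rewrite half; apply.
apply: filterS3 WXY (L0scaleE 2 X) (L0scaleE 2 Y) => w h -> ->.
by rewrite !mulrA mulVf// !mul1r.
Qed.

Hypothesis phi_fin : forall X, S X -> phi X \is a fin_num.
Hypothesis phi_vanish : forall (U_ : nat -> L0) Y, S Y ->
  (forall n, \forall w \ae P, 0 <= U_ n w <= Y w) ->
  (\forall w \ae P, (fun n => U_ n w) @ \oo --> (0 : R)) ->
  forall e : R, 0 < e -> \forall n \near \oo, (phi (U_ n) <= e%:E)%E.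

(** Order continuity at 0 from above suffices.  With U = |X_n - X| and
    0 < q < 1,
    X_n <= (1-q) X + q (X + U/q)  and
    X <= (1-q) X_n + q (X + (1 + 1/q) U).
    Eventually phi(X + k U) <= C := phi(2X)/2 + 1/2 for each fixed k, since
    X + k U = (2X)/2 + (2kU)/2 and phi(2kU) <= 1.  So phi(X_n) and phi(X)
    differ by a multiple of q, which is arbitrarily small. *)
Lemma Lebesgue_of_vanishing : Lebesgue_property S phi.
Proof.
move=> X_ X Y SX_ SY Y0 XY Xcvg; have [[_ SD SZ] sol] := S_solid.
have XleY : \forall w \ae P, `|X w| <= Y w.
  apply: filterS2 (ae_foralln XY) Xcvg => w h /cvg_norm c.
  rewrite -(cvg_lim _ c)//; apply: limr_le; first by apply/cvg_ex; eexists; exact: c.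
  exact: nearW.
have SX : S X.
  by apply: sol SY; apply: filterS XleY => w h; rewrite (le_trans h)// ler_norm.
pose U n := L0abs (L0add (X_ n) (L0scale (-1) X)).
have UE n : \forall w \ae P, U n w = `|X_ n w - X w|.
  apply: filterS3 (L0absE (L0add (X_ n) (L0scale (-1) X)))
    (L0addE (X_ n) (L0scale (-1) X)) (L0scaleE (-1) X).
  by move=> w -> -> ->; rewrite mulN1r.
have SU n : S (U n) by apply: solid_abs; apply: SD => //; exact: SZ.
have kU_le (k : R) n : 0 <= k ->
    \forall w \ae P, 0 <= L0scale k (U n) w <= L0scale (k * 2) Y w.
  move=> k0; apply: (filter_app _ _ (UE n)).
  apply: (filter_app _ _ (L0scaleE (k * 2) Y)); apply: (filter_app _ _ (XY n)).
  apply: filterS2 XleY (L0scaleE k (U n)) => w h1 -> h2 -> ->.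
  rewrite mulr_ge0//= -mulrA ler_wpM2l//.
  by rewrite (le_trans (ler_normB _ _))//; lra.
have kU_small (k : R) : 0 <= k -> \forall n \near \oo, (phi (L0scale k (U n)) <= 1%:E)%E.
  move=> k0; apply: (phi_vanish (SZ (k * 2) _ SY)) => // [n|]; first exact: kU_le.
  apply: filterS3 Xcvg (ae_foralln UE) (ae_foralln (fun n => L0scaleE k (U n))).
  move=> w c hU hk; rewrite (_ : (fun n => _) =
    (fun n => k * `|X_ n w - X w|)); last first.
    by apply/funext => n; rewrite hk hU.
  have : `|X_ n w - X w| @[n --> \oo] --> (0 : R).
    by apply/norm_cvg0P; apply/subr_cvg0.
  by move/(cvgM (cvg_cst k)); rewrite mulr0; apply.
pose f Z := fine (phi Z).
have fE Z : S Z -> phi Z = (f Z)%:E by move=> SZ'; rewrite fineK// phi_fin.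
pose C := 2^-1 * f (L0scale 2 X) + 2^-1.
pose V k n := L0add X (L0scale k (U n)).
have SV k n : S (V k n) by apply: SD => //; exact: SZ.
have VE k n : \forall w \ae P, V k n w = X w + k * `|X_ n w - X w|.
  by apply: filterS3 (L0addE X (L0scale k (U n))) (L0scaleE k (U n)) (UE n) => w -> -> ->.
have VC k : 0 <= k -> \forall n \near \oo, f (V k n) <= C.
  move=> k0; have k20 : 0 <= k * 2 by rewrite mulr_ge0.
  apply: filterS (kU_small _ k20) => n h.
  rewrite -lee_fin -fE// (le_trans (mono_convex_half SX (SZ k _ (SU n)) (SV k n) _))//.
    by apply: filterS (L0addE X (L0scale k (U n))) => w ->.
  rewrite /C EFinD EFinM -fE; last exact: SZ.
  apply: leeD => //; rewrite -[leRHS]mule1 lee_wpmul2l ?lee_fin//.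
  apply: le_trans h; apply: phi_mono; [exact/SZ/SZ|exact: SZ|].
  apply: filterS3 (L0scaleE 2 (L0scale k (U n))) (L0scaleE k (U n))
    (L0scaleE (k * 2) (U n)).
  by move=> w -> -> ->; rewrite mulrA [2 * k]mulrC.
rewrite (fE _ SX); apply/cvge_finP => e e0.
pose D := `|C - f X| + 1.
have D0 : 0 < D by rewrite ltr_wpDl.
(* q (C - f X) <= e/2 handles the upper bound; q <= 1/2 absorbs the division
   by 1 - q in the lower one. *)
pose q := Num.min 2^-1 (e / (2 * D)).
have q0 : 0 < q by rewrite lt_min invr_gt0 ltr0n divr_gt0// mulr_gt0.
have q12 : q <= 2^-1 by rewrite ge_min lexx.
have q01 : 0 <= 1 - q <= 1 by apply/andP; split; lra.
have qD : q * D <= e / 2.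
  have : q <= e / (2 * D) by rewrite ge_min lexx orbT.
  by rewrite ler_pdivlMr ?mulr_gt0// => h; lra.
have qc : q * (C - f X) <= e / 2.
  apply: le_trans qD; rewrite ler_wpM2l//; first exact: ltW.
  by have := ler_norm (C - f X); rewrite /D; lra.
have k1 : 0 <= q^-1 by rewrite invr_ge0 ltW.
have k2 : 0 <= 1 + q^-1 by rewrite addr_ge0.
apply: filterS2 (VC _ k1) (VC _ k2) => n V1 V2.
have qq : 1 - (1 - q) = q by lra.
have step1 : f (X_ n) <= (1 - q) * f X + q * f (V q^-1 n).
  rewrite -lee_fin EFinD !EFinM -!fE//.
  have := mono_convex_le q01 SX (SV q^-1 n) (SX_ n); rewrite qq; apply.
  apply: filterS (VE q^-1 n) => w ->.
  rewrite mulrDr mulrA mulfV ?gt_eqF// mul1r.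
  have := ler_norm (X_ n w - X w); lra.
have step2 : f X <= (1 - q) * f (X_ n) + q * f (V (1 + q^-1) n).
  rewrite -lee_fin EFinD !EFinM -!fE//.
  have := mono_convex_le q01 (SX_ n) (SV (1 + q^-1) n) SX; rewrite qq; apply.
  apply: filterS (VE (1 + q^-1) n) => w ->.
  rewrite mulrDr mulrA [q * (1 + _)]mulrDr mulfV ?gt_eqF// mulr1.
  have : - `|X_ n w - X w| <= X_ n w - X w by rewrite lerNl -normrN ler_norm.
  have := normr_ge0 (X_ n w - X w).
  nra.
have h1 : q * f (V q^-1 n) <= q * C by rewrite ler_pM2l.
have h2 : q * f (V (1 + q^-1) n) <= q * C by rewrite ler_pM2l.
rewrite (fE _ (SX_ n)) !lee_fin; apply/andP; split; nra.
Qed.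

End Lebesgue_criterion.

(** * Tails and truncations *)
Section tails.
Context d (T : measurableType d) (R : realType) (P : probability T R).
Local Notation L0 := {mfun_ P, T >-> R}.
Implicit Types X Y Z : L0.

Lemma L0tail_ge0 a N X : 0 <= a -> L0le (L0cst P 0) (L0tail a N X).
Proof.
move=> a0; apply: filterS2 (L0cstE P 0) (L0tailE a N X) => w -> ->.
by case: ifP => // _; exact: mulr_ge0.
Qed.

Lemma le_L0tail a b N n X Y : 0 <= a ->
  (\forall w \ae P, n%:R < `|X w| -> N%:R < `|Y w| /\ a * `|X w| <= b * `|Y w|) ->
  0 <= b -> L0le (L0tail a n X) (L0tail b N Y).
Proof.
move=> a0 XY b0; apply: filterS3 (L0tailE a n X) (L0tailE b N Y) XY => w -> -> h.
case: ifPn => [/h[-> //]|_]; case: ifPn => // _; exact: mulr_ge0.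
Qed.

Lemma L0scale_tail b a N X : L0scale b (L0tail a N X) = L0tail (b * a) N X.
Proof.
apply: L0_eq; apply: filterS3 (L0scaleE b (L0tail a N X)) (L0tailE a N X)
  (L0tailE (b * a) N X) => w -> -> ->.
by case: ifP => _; rewrite ?mulr0// mulrA.
Qed.

(** If |Y| <= N then U is not truncated; otherwise the tail of Y dominates U. *)
Lemma le_clamp_tail (U Y : L0) N : (\forall w \ae P, 0 <= U w <= `|Y w|) ->
  \forall w \ae P, U w <= L0clamp N%:R U w + L0tail 1 N Y w.
Proof.
move=> UY; apply: filterS3 (L0clampE N%:R U) (L0tailE 1 N Y) UY => w -> ->.
move=> /andP[U0 UY']; rewrite clamp_ge0//.
case: ltP => h; last by rewrite addr0 (min_idPl (le_trans UY' h)).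
rewrite mul1r; have : 0 <= Num.min (U w) N%:R by rewrite le_min U0/=.
lra.
Qed.

Lemma Lfun1_ge0 (Y : L0) Z : L0le (L0cst P 0) Y -> (\forall w \ae P, 0 <= Z w) ->
  ('E_P[(Y : T -> R) \* Z] < +oo)%E -> (Y : T -> R) \* Z \in Lfun P 1%E.
Proof.
move=> Y0 Z0 fin; apply/Lfun1_integrable/integrableP.
have mYZ : measurable_fun setT (EFin \o ((Y : T -> R) \* Z)).
  by apply/measurable_EFinP; exact: measurable_L0M.
split => //; apply: le_lt_trans fin; rewrite unlock le_eqVlt; apply/orP; left.
apply/eqP/ae_eq_integral => //; first exact: measurableT_comp.
apply: filterS3 Y0 Z0 (L0cstE P 0) => w h1 h2 h3 _ /=.
by rewrite ger0_norm// mulr_ge0// -h3.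
Qed.

Lemma integral_truncated_le X Z (B : \bar R) :
  (forall n, \int[P]_w (Num.min `|X w| n%:R * `|Z w|)%:E <= B)%E ->
  (\int[P]_w (`|X w * Z w|)%:E <= B)%E.
Proof.
move=> hB; pose g n w := (Num.min `|X w| n%:R * `|Z w|)%:E.
have gcvg w : (g n w @[n --> \oo] --> (`|X w * Z w|)%:E)%E.
  apply: cvg_near_cst.
  exists (Num.bound `|X w|) => // n /= hn; rewrite /g normrM.
  rewrite (_ : Num.min _ _ = `|X w|)//; apply/min_idPl.
  by rewrite ltW// (lt_le_trans (archi_boundP (normr_ge0 _)))// ler_nat.
have -> : (\int[P]_w (`|X w * Z w|)%:E = \int[P]_w limn (g ^~ w))%E.
  by apply: eq_integral => w _; apply/esym/cvg_lim.
have mg n : measurable_fun setT (g n).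
  apply/measurable_EFinP; apply: measurable_funM.
    by apply: measurable_minr => //; apply: measurableT_comp => //; exact: measurable_L0.
  by apply: measurableT_comp => //; exact: measurable_L0.
have h : (\int[P]_w g n w @[n --> \oo] --> \int[P]_w limn (g ^~ w))%E.
  apply: (@cvg_monotone_convergence _ _ _ P _ measurableT g) => // [n w _|w _ m n mn].
    by rewrite lee_fin mulr_ge0// le_min normr_ge0 ler0n.
  by rewrite lee_fin ler_wpM2r// le_min !ge_min lexx/= ler_nat mn orbT.
rewrite -(cvg_lim _ h)//; apply: lime_le; first by apply/cvg_ex; eexists; exact: h.
by apply: nearW => n; exact: hB.
Qed.

End tails.

(** * The space M_u *)
Section M_u.
Context d (T : measurableType d) (R : realType) (P : probability T R).
Local Notation L0 := {mfun_ P, T >-> R}.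
Implicit Types X Y Z : L0.
Variable phi0 : L0 -> R.
Hypothesis phi0_mc : monotone_convex (Linfty P) (fun X => (phi0 X)%:E).
Hypothesis phi0_Leb : Lebesgue_property (Linfty P) (fun X => (phi0 X)%:E).
Hypothesis phi0_0 : phi0 (L0cst P 0) = 0.

Local Notation dom := (dom_conjugate phi0).
Local Notation conj := (conjugate phi0).
Local Notation phih := (phi_hat phi0).
Local Notation Idom := (dom_integrable phi0).
Local Notation Mu := (M_u phi0).

Let Idom_solid : solid_space Idom := dom_integrable_solid phi0.
Let phih_mono : monotone_on Idom phih := phi_hat_mono phi0_mc phi0_0.
Let phih_convex : convex_on Idom phih := phi_hat_convex phi0_0.
Let conj_fin Z : dom Z -> conj Z \is a fin_num := conjugate_fin_num phi0_0 (Z := Z).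

Let Idom_tail a N X : Idom X -> Idom (L0tail a N X) := solid_tail Idom_solid a N (X := X).

Lemma phi_hat_ge0 X : Idom X -> L0le (L0cst P 0) X -> (0 <= phih X)%E.
Proof.
move=> IX X0; rewrite -(phi_hat_0 phi0_mc phi0_Leb phi0_0); apply: phih_mono => //.
exact/Linfty_dom_integrable/Linfty_cst.
Qed.

(** |X| <= N + |X| 1_{|X|>N}, and constants are integrable against dom. *)
Lemma dom_integrable_of_tail X N : Idom (L0tail 1 N X) -> Idom X.
Proof.
move=> It; have [[_ ID _] sol] := Idom_solid.
have Ic : Idom (L0cst P N%:R) by exact/Linfty_dom_integrable/Linfty_cst.
apply: (sol _ _ _ (ID _ _ Ic It)).
apply: (filter_app _ _ (L0addE (L0cst P N%:R) (L0tail 1 N X))).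
apply: filterS2 (L0cstE P N%:R) (L0tailE 1 N X) => w -> -> ->.
rewrite [leRHS]ger0_norm; last first.
  by rewrite addr_ge0//; case: ifP => // _; exact: mulr_ge0.
by case: ltP => h; rewrite ?mul1r ?lerDr ?addr0.
Qed.

Lemma dom_integrable_of_bound X (c : R) : L0le (L0cst P 0) X ->
  (forall Z, dom Z -> ('E_P[(X : T -> R) \* Z] <= c%:E + conj Z)%E) -> Idom X.
Proof.
move=> X0 h Z dZ; apply: Lfun1_ge0 => //; first exact: dom_ge0 dZ.
apply: (le_lt_trans (h Z dZ)).
by rewrite -(fineK (conj_fin dZ)) -EFinD ltry.
Qed.

Lemma M_u_dom_integrable : Mu `<=` Idom.
Proof.
move=> X MX; have := MX 1 ltr01 => /(cvge_finP _ 0)/(_ 1 ltr01)[N _ /(_ N (leqnn N))].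
rewrite sub0r add0r => /andP[_ hN].
apply: (@dom_integrable_of_tail _ N); apply: (@dom_integrable_of_bound _ 1).
  exact: L0tail_ge0.
move=> Z dZ; rewrite -leeBlDr ?conj_fin//; apply: le_trans hN.
by apply: ereal_sup_ubound; exists Z.
Qed.

(** The tails decrease in N and phi_hat is nonnegative on them, so one small
    value gives convergence to 0. *)
Lemma M_u_of_small_tails X : Idom X -> (forall a e : R, 0 < a -> 0 < e ->
  exists N, (phih (L0tail a N X) <= e%:E)%E) -> Mu X.
Proof.
move=> IX h a a0; apply/(cvge_finP _ 0) => e e0; have [N hN] := h a e a0 e0.
exists N => // n /= Nn; rewrite sub0r add0r; apply/andP; split.
  apply: (@le_trans _ _ 0%E); first by rewrite lee_fin oppr_le0 ltW.
  by apply: phi_hat_ge0; [exact: Idom_tail|apply: L0tail_ge0; exact: ltW].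
apply: le_trans hN; apply: phih_mono; [exact: Idom_tail|exact: Idom_tail|].
apply: le_L0tail; [exact: ltW| |exact: ltW].
apply: nearW => w hw; split => //; apply: le_lt_trans hw.
by rewrite ler_nat.
Qed.

Lemma M_u_small_tail X (a e : R) : Mu X -> 0 < a -> 0 < e ->
  exists N, forall n, (N <= n)%N -> (phih (L0tail a n X) <= e%:E)%E.
Proof.
move=> MX a0 e0; have := MX a a0 => /(cvge_finP _ 0)/(_ e e0)[N _ hN].
by exists N => n Nn; have /andP[_] := hN n Nn; rewrite add0r.
Qed.

Lemma Linfty_M_u : Linfty P `<=` Mu.
Proof.
move=> X LX; have [M [M0 XM]] := (LinftyP X).1 LX.
apply: M_u_of_small_tails => [|a e a0 e0]; first exact: Linfty_dom_integrable.
exists (Num.bound M); rewrite (_ : L0tail _ _ _ = L0cst P 0).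
  by rewrite (phi_hat_0 phi0_mc phi0_Leb phi0_0) lee_fin ltW.
apply: L0_eq; apply: filterS3 XM (L0tailE a (Num.bound M) X) (L0cstE P 0) => w h -> ->.
rewrite ifF//; apply/negbTE; rewrite -leNgt (le_trans h)// ltW//.
exact: archi_boundP.
Qed.

(** For sums, |X + Y| > 2n forces max(|X|, |Y|) > n, so the tail of X + Y at 2n
    is at most twice the sum of the tails of X and Y at n; convexity then
    replaces the factor 2 by a factor 4 in each tail. For b X with |b| < k the
    tail at k N is at most k times the tail of X at N. *)
Lemma M_u_solid : solid_space Mu.
Proof.
have [[_ ID IZ] sol] := Idom_solid.
have Msol X Y : (\forall w \ae P, `|X w| <= `|Y w|) -> Mu Y -> Mu X.
  move=> XY MY; have IY := M_u_dom_integrable MY; have IX := sol _ _ XY IY.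
  apply: M_u_of_small_tails => // a e a0 e0; have [N /(_ N (leqnn N)) hN] := M_u_small_tail MY a0 e0.
  exists N; apply: le_trans hN; apply: phih_mono; [exact: Idom_tail|exact: Idom_tail|].
  apply: le_L0tail; [exact: ltW| |exact: ltW].
  apply: filterS XY => w h hN; split; first exact: lt_le_trans hN h.
  by rewrite ler_pM2l.
split=> //; split.
- exact/Linfty_M_u/Linfty_cst.
- move=> X Y MX MY; have [IX IY] := (M_u_dom_integrable MX, M_u_dom_integrable MY).
  have IXY := ID _ _ IX IY.
  apply: M_u_of_small_tails => // a e a0 e0; have a20 : 0 < a * 2 by rewrite mulr_gt0.
  have a40 : 0 < 2 * (a * 2) by rewrite mulr_gt0.
  have [N hN] := M_u_small_tail MX a40 e0; have [N' hN'] := M_u_small_tail MY a40 e0.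
  pose n := maxn N N'; exists (2 * n)%N.
  have := @mono_convex_half _ _ _ _ _ _ Idom_solid phih_convex phih_mono
    (L0tail (a * 2) n X) (L0tail (a * 2) n Y) (L0tail a (2 * n) (L0add X Y))
    (Idom_tail _ _ IX) (Idom_tail _ _ IY) (Idom_tail _ _ IXY).
  rewrite !L0scale_tail => h; apply: le_trans (h _) _.
    apply: (filter_app _ _ (L0tailE (a * 2) n X)).
    apply: (filter_app _ _ (L0tailE (a * 2) n Y)).
    apply: (filter_app _ _ (L0tailE a (2 * n) (L0add X Y))).
    apply: filterS (L0addE X Y) => w -> -> -> ->; rewrite natrM.
    have := ler_normD (X w) (Y w).
    have := normr_ge0 (X w); have := normr_ge0 (Y w).
    case: ltP => hXY; case: ltP => hX; case: ltP => hY; nra.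
  apply: lee_half_sum; first by apply: hN; rewrite leq_maxl.
  by apply: hN'; rewrite leq_maxr.
- move=> b X MX; have IX := M_u_dom_integrable MX; have IbX := IZ b X IX.
  apply: M_u_of_small_tails => // a e a0 e0.
  pose k := (Num.bound `|b|); have bk : `|b| < k%:R by exact: archi_boundP.
  have k0 : 0 < k%:R :> R by exact: le_lt_trans bk.
  have ak0 : 0 < a * k%:R by rewrite mulr_gt0.
  have [N /(_ N (leqnn N)) hN] := M_u_small_tail MX ak0 e0.
  exists (k * N)%N; apply: le_trans hN.
  apply: phih_mono; [exact: Idom_tail|exact: Idom_tail|].
  apply: le_L0tail; [exact: ltW| |exact: ltW].
  apply: filterS (L0scaleE b X) => w ->; rewrite normrM natrM => h.
  have X0 := normr_ge0 (X w).
  have bX : `|b| * `|X w| <= k%:R * `|X w| by rewrite ler_wpM2r// ltW.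
  split; last by rewrite -mulrA ler_pM2l.
  by rewrite -(ltr_pM2l k0) (lt_le_trans h).
Qed.

(** X <= clamp_N(|X|) + tail_N(X): phi_hat of twice the first term is a value
    of phi0, and of twice the second is at most 1 for large N. *)
Lemma M_u_fin X : Mu X -> phih X \is a fin_num.
Proof.
move=> MX; have IX := M_u_dom_integrable MX; rewrite fin_numE -ltNye -ltey.
apply/andP; split.
  have [Z dZ] := dom_nonempty phi0_mc phi0_Leb phi0_0.
  by apply: lt_le_trans (phi_hat_ge phi0_0 IX dZ); rewrite ltNyr.
have [N /(_ N (leqnn N)) hN] := M_u_small_tail MX (ltr0Sn R 1) ltr01.
have LA := Linfty_clamp (L0abs X) N.
have [[_ _ LZ] _] := Linfty_solid P.
apply: le_lt_trans (mono_convex_half Idom_solid phih_convex phih_mono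
  (Linfty_dom_integrable LA) (solid_tail Idom_solid 1 N IX) IX _) _.
  have XX : \forall w \ae P, 0 <= L0abs X w <= `|X w|.
    by apply: filterS (L0absE X) => w ->; rewrite normr_ge0/=.
  apply: filterS2 (le_clamp_tail N XX) (L0absE X) => w h hX.
  by apply: le_trans h; rewrite hX ler_norm.
rewrite phi_hat_Linfty//; last exact: LZ.
rewrite L0scale_tail mulr1.
apply: (@le_lt_trans _ _ (2^-1%:E * (phi0 (L0scale 2 (L0clamp N%:R (L0abs X))))%:E +
  2^-1%:E * 1%:E)%E); last by rewrite -!EFinM -EFinD ltry.
by rewrite leeD2l// lee_wpmul2l// lee_fin.
Qed.

Lemma M_u_mono : monotone_on Mu phih.
Proof. by move=> X Y /M_u_dom_integrable IX /M_u_dom_integrable IY; exact: phih_mono. Qed.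

Lemma M_u_convex : convex_on Mu phih.
Proof.
move=> t X Y t01 /M_u_dom_integrable IX /M_u_dom_integrable IY.
exact: phih_convex.
Qed.

(** For 0 <= U_n <= Y, choose N with phi_hat(2 Y 1_{Y>N}) <= e; the remaining
    part 2 clamp_N(U_n) is uniformly bounded and tends to 0, so phi0 of it
    tends to 0. *)
Lemma M_u_Lebesgue : Lebesgue_property Mu phih.
Proof.
apply: (Lebesgue_of_vanishing M_u_solid M_u_convex M_u_mono M_u_fin).
move=> U Y MY UY U0 e e0; have [[_ _ MZ] sol] := M_u_solid.
have MU n : Mu (U n).
  apply: sol MY; apply: filterS (UY n) => w /andP[h1 h2].
  by rewrite !ger0_norm// (le_trans h1).
have [N /(_ N (leqnn N)) hN] := M_u_small_tail MY (ltr0Sn R 1) e0.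
pose C n := L0scale 2 (L0clamp N%:R (U n)).
have CE n : \forall w \ae P, C n w = 2 * Num.min (U n w) N%:R.
  apply: filterS3 (L0scaleE 2 (L0clamp N%:R (U n))) (L0clampE N%:R (U n)) (UY n).
  by move=> w -> -> /andP[h1 _]; rewrite clamp_ge0.
have C_bound n : \forall w \ae P, `|C n w| <= 2 * N%:R.
  apply: filterS2 (CE n) (UY n) => w -> /andP[h1 _].
  by rewrite ger0_norm ?mulr_ge0 ?le_min ?h1//= ler_pM2l// ge_min lexx orbT.
have LC n : Linfty P (C n).
  by apply/LinftyP; exists (2 * N%:R); split => //; exact: mulr_ge0.
have : (fun n => (phi0 (C n))%:E) @ \oo --> (phi0 (L0cst P 0))%:E.
  apply: (phi0_Leb (Y := L0cst P (2 * N%:R))) => //.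
  - exact: Linfty_cst.
  - by apply: filterS2 (L0cstE P 0) (L0cstE P (2 * N%:R)) => w -> ->; exact: mulr_ge0.
  - by move=> n; apply: filterS2 (C_bound n) (L0cstE P (2 * N%:R)) => w h ->.
  - apply: (filter_app _ _ (L0cstE P 0)); apply: (filter_app _ _ U0).
    apply: filterS2 (ae_foralln UY) (ae_foralln CE) => w hU hC c ->.
    rewrite (_ : (fun n => _) = (fun n => 2 * Num.min (U n w) N%:R)); last first.
      by apply/funext => n; rewrite hC.
    have c2 : 2 * U n w @[n --> \oo] --> (0 : R).
      by move/(cvgM (cvg_cst (2 : R))) : c; rewrite mulr0; apply.
    apply: (squeeze_cvgr _ (cvg_cst 0) c2); apply: nearW => n.
    have /andP[h1 _] := hU n.
    by rewrite mulr_ge0 ?le_min ?h1//= ler_pM2l// ge_min lexx.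
rewrite phi0_0 => /cvge_finP/(_ e e0); apply: filterS => n /andP[_].
rewrite add0r => hC.
apply: (le_trans (mono_convex_half M_u_solid M_u_convex M_u_mono
  (solid_clamp M_u_solid (ler0n R N) (MU n)) (solid_tail M_u_solid 1 N MY) (MU n) _)).
  apply: le_clamp_tail; apply: filterS (UY n) => w /andP[h1 h2].
  by rewrite h1 (le_trans h2)// ler_norm.
rewrite L0scale_tail mulr1; apply: lee_half_sum => //.
by rewrite -/(C n) phi_hat_Linfty.
Qed.

Lemma M_u_extension : Lebesgue_extension phi0 phih Mu.
Proof.
split; [exact: M_u_solid|exact: Linfty_M_u| |exact: M_u_Lebesgue|].
  split; [split|exact: M_u_convex|exact: M_u_mono].
    by move=> X /M_u_fin; rewrite fin_numE -ltNye => /andP[].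
  exists (L0cst P 0); first exact/Linfty_M_u/Linfty_cst.
  by rewrite (phi_hat_0 phi0_mc phi0_Leb phi0_0).
by move=> X; exact: phi_hat_Linfty.
Qed.

Lemma M_u_D0 : Mu `<=` D0 phi0.
Proof.
move=> X /M_u_dom_integrable IX Z dZ; apply/Lfun1_integrable.
have /Lfun1_integrable := IX Z dZ; apply: ae_le_integrable.
  by apply: measurable_funM; [apply: measurable_funrneg|]; exact: measurable_L0.
apply: nearW => w; rewrite /= !normrM ler_wpM2r//.
rewrite /funrneg ger0_norm ?le_max ?lexx ?orbT// ge_max normr_ge0 andbT.
by rewrite -normrN ler_norm.
Qed.

(** * Maximality *)
Section maximality.
Variables (phi : L0 -> \bar R) (S : set L0).
Hypothesis ext : Lebesgue_extension phi0 phi S.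

(** For Z in dom, E[min(Y,n) Z] <= phi0(min(Y,n)) + conjugate(Z)
    <= phi(Y) + conjugate(Z); let n tend to infinity. *)
Lemma phi_hat_le_extension Y (e : R) : S Y -> L0le (L0cst P 0) Y -> (phi Y <= e%:E)%E ->
  Idom Y /\ (phih Y <= e%:E)%E.
Proof.
case: ext => sol LS [_ _ mono] _ phiE SY Y0 Ye.
have bound Z : dom Z -> ('E_P[(Y : T -> R) \* Z] <= e%:E + conj Z)%E.
  move=> dZ; have Z0 := dom_ge0 phi0_mc phi0_0 dZ; have [LZ _] := dZ.
  have mYZ := measurable_L0M Y Z.
  have -> : ('E_P[(Y : T -> R) \* Z] = \int[P]_w (`|Y w * Z w|)%:E)%E.
    rewrite unlock; apply: ae_eq_integral => //.
    - exact/measurable_EFinP.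
    - by apply/measurable_EFinP; exact: measurableT_comp.
    - apply: filterS3 Y0 Z0 (L0cstE P 0) => w h1 h2 h3 _ /=.
      by rewrite ger0_norm// mulr_ge0// -h3.
  apply: integral_truncated_le => n.
  have -> : (\int[P]_w (Num.min `|Y w| n%:R * `|Z w|)%:E =
      'E_P[(L0clamp n%:R Y : T -> R) \* Z])%E.
    rewrite unlock; apply: ae_eq_integral => //.
    - apply/measurable_EFinP; apply: measurable_funM.
        by apply: measurable_minr => //; exact: measurableT_comp.
      by apply: measurableT_comp => //; exact: measurable_L0.
    - by apply/measurable_EFinP; exact: measurable_L0M.
    - apply: (filter_app _ _ (L0clampE n%:R Y)).
      apply: filterS3 Y0 Z0 (L0cstE P 0) => w h1 h2 h3 h4 _ /=.
      rewrite h3 in h1.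
      by rewrite h4 clamp_ge0// !ger0_norm.
  have LC := Linfty_clamp Y n.
  have := conjugate_ge phi0 LC LZ.
  rewrite pairingE; last exact: Lfun1_Linfty.
  have : (phi (L0clamp n%:R Y) <= phi Y)%E.
    apply: mono => //; first exact: LS.
    apply: filterS3 Y0 (L0cstE P 0) (L0clampE n%:R Y) => w h1 h2 ->.
    by rewrite h2 in h1; rewrite clamp_ge0// ge_min lexx.
  rewrite phiE// => /le_trans/(_ Ye).
  by rewrite -(fineK (conj_fin dZ)) -EFinD !lee_fin; lra.
have IY : Idom Y by exact: dom_integrable_of_bound bound.
split => //; apply: ub_ereal_sup => _ [Z dZ <-].
by rewrite leeBlDr ?conj_fin ?bound.
Qed.

(** a |X| 1_{|X|>N} is dominated by a |X| in S and tends to 0, so phi sends it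
    to phi(0) = 0, and phi_hat lies below phi there. *)
Lemma extension_sub_M_u : S `<=` Mu.
Proof.
move=> X SX; case: (ext) => sol LS [_ _ mono] Leb phiE; have [[_ _ SZ] _] := sol.
have tails (a e : R) : 0 < a -> 0 < e -> exists N, (phi (L0tail a N X) <= e%:E)%E.
  move=> a0 e0.
  have : (fun N => phi (L0tail a N X)) @ \oo --> phi (L0cst P 0).
    apply: (Leb _ _ (L0scale a (L0abs X))).
    - by move=> n; exact: (solid_tail sol).
    - by apply: SZ; exact: (solid_abs sol).
    - apply: filterS3 (L0cstE P 0) (L0scaleE a (L0abs X)) (L0absE X) => w -> -> ->.
      by rewrite mulr_ge0// ltW.
    - move=> n; apply: filterS3 (L0tailE a n X) (L0scaleE a (L0abs X)) (L0absE X).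
      move=> w -> -> ->; have h : 0 <= a * `|X w| by rewrite mulr_ge0// ltW.
      by case: ifP => _; rewrite ?normr0// ger0_norm.
    - apply: filterS2 (ae_foralln (fun n => L0tailE a n X)) (L0cstE P 0) => w h ->.
      apply: cvg_near_cst; exists (Num.bound `|X w|) => // n hn; rewrite h.
      rewrite ifF//; apply/negbTE; rewrite -leNgt ltW//.
      by rewrite (lt_le_trans (archi_boundP (normr_ge0 _)))// ler_nat.
  rewrite phiE ?phi0_0; last exact: Linfty_cst.
  move=> /cvge_finP/(_ e e0)[N _ /(_ N (leqnn N))]; rewrite sub0r add0r => /andP[_ hN].
  by exists N.
have tails' (a e : R) : 0 < a -> 0 < e ->
    exists N, Idom (L0tail a N X) /\ (phih (L0tail a N X) <= e%:E)%E.
  move=> a0 e0; have [N hN] := tails a e a0 e0; exists N.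
  by apply: phi_hat_le_extension => //; [exact: (solid_tail sol)|apply: L0tail_ge0; exact: ltW].
apply: M_u_of_small_tails; first by have [N [/dom_integrable_of_tail]] := tails' 1 1 ltr01 ltr01.
by move=> a e a0 e0; have [N [_ hN]] := tails' a e a0 e0; exists N.
Qed.

(** Both functions have the Lebesgue property and agree with phi0 on the
    truncations of X, which are bounded and dominated by |X|. *)
Lemma extension_eq_phi_hat X : S X -> phi X = phih X.
Proof.
move=> SX; case: (ext) => sol LS _ Leb phiE.
have h1 := Lebesgue_clamp_cvg sol Leb SX.
have h2 := Lebesgue_clamp_cvg M_u_solid M_u_Lebesgue (extension_sub_M_u SX).
apply: (cvg_unique _ h1) => //.
rewrite (_ : (fun n => _) = (fun n => phih (L0clamp n%:R X)))//.
apply/funext => n; rewrite phiE ?phi_hat_Linfty//; exact: Linfty_clamp.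
Qed.

End maximality.
End M_u.

Theorem theorem3p5 (d : measure_display) (T : measurableType d) (R : realType)
    (P : probability T R) (phi0 : {mfun_ P, T >-> R} -> R)
    (phi0_mc : monotone_convex (Linfty P) (fun X => (phi0 X)%:E))
    (phi0_Leb : Lebesgue_property (Linfty P) (fun X => (phi0 X)%:E))
    (phi0_0 : phi0 (L0cst P 0) = 0) :
  [/\ maximum_Lebesgue_extension phi0 (phi_hat phi0) (M_u phi0),
      M_u phi0 `<=` D0 phi0,
      finite_Lebesgue_extension phi0 (phi_hat phi0) (M_u phi0) &
      forall (phi : {mfun_ P, T >-> R} -> \bar R)
             (S : set {mfun_ P, T >-> R}),
        finite_Lebesgue_extension phi0 phi S ->
        S `<=` M_u phi0 /\ forall X, S X -> phi X = phi_hat phi0 X].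
Proof.
have Mext := M_u_extension phi0_mc phi0_Leb phi0_0.
have max phi S : Lebesgue_extension phi0 phi S ->
    S `<=` M_u phi0 /\ forall X, S X -> phi X = phi_hat phi0 X.
  move=> ext; split; first exact: (extension_sub_M_u phi0_mc phi0_Leb phi0_0 ext).
  by move=> X; exact: (extension_eq_phi_hat phi0_mc phi0_Leb phi0_0 ext).
have [sol LS mc Leb phiE] := Mext.
split => //; first exact: M_u_D0.
- split => // [c|X MX]; first exact/LS/Linfty_cst.
  exact: M_u_fin.
- move=> phi S [Ssol Scst Sfin [Smc SLeb] SE]; apply: max; split => //.
  move=> X /LinftyP[M [M0 XM]]; have [_ sub] := Ssol.
  apply: sub (Scst M); apply: filterS2 XM (L0cstE P M) => w h ->.
  by rewrite (ger0_norm M0).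
Qed.
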